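(* Let $n\ge 3$ and let $r$ be an analytic tensor field of type $(0,2)$ around $0\in\mathbb{R}^n$. The family of all real analytic linear connections $\nabla$ with $\tau=0$ and $\mathrm{Ric}=r$ depends bijectively on $n^3-n^2-n$ analytic functions of $n$ variables and $n^2$ analytic functions of $n-1$ variables.
   Context: Connections, tensor fields and functions in a neighborhood of $0$ are understood as their germs at $0$. For a linear connection $\nabla$ with torsion $T(X,Y)=\nabla_XY-\nabla_YX-[X,Y]$, $\tau$ is the $1$-form $\tau(Y)=\mathrm{tr}(X\mapsto T(X,Y))$. In an analytic coordinate system $(x^1,\dots,x^n)$, with Christoffel symbols given by $\nabla_{\partial_i}\partial_j=\sum_k\Gamma^k_{ij}\partial_k$, the Ricci tensor of $\nabla$ is $$\mathrm{Ric}(\partial_i,\partial_j)=\sum_{k=1}^n\Big[\tfrac{\partial\Gamma^k_{ij}}{\partial x^k}-\tfrac{\partial\Gamma^k_{kj}}{\partial x^i}\Big]+\sum_{k,l=1}^n\big[\Gamma^l_{ij}\Gamma^k_{kl}-\Gamma^l_{kj}\Gamma^k_{il}\big].$$ *)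

(* Defs.v *)
From HB Require Import structures.
From mathcomp Require Import all_boot all_order all_algebra.
From mathcomp Require Import all_classical all_reals all_analysis.

Set Implicit Arguments.
Unset Strict Implicit.
Unset Printing Implicit Defensive.

Import Order.TTheory GRing.Theory Num.Theory.
Import numFieldNormedType.Exports.

Local Open Scope classical_set_scope.
Local Open Scope ring_scope.

(* R^n is 'rV[R]_n.  A germ at 0 is represented by a total function on R^n;    *)
(* f and g have the same germ when {near 0, f =1 g}, and every notion below    *)
(* only depends on the germs of the objects involved.                          *)

Section AnalyticGerms.
Variables (R : realType) (n : nat).

Definition monomial (x : 'rV[R]_n) (a : {ffun 'I_n -> nat}) : R :=
  \prod_(i < n) x 0 i ^+ a i.

(* Partial sum over the multi-indices with all entries < N; for an absolutely  *)
(* convergent power series these converge to its unconditional sum.            *)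
Definition power_series_box (c : {ffun 'I_n -> nat} -> R) (x : 'rV[R]_n)
    (N : nat) : R :=
  \sum_(a : {ffun 'I_n -> 'I_N})
     let a' := [ffun i => a i : nat] in c a' * monomial x a'.

Definition analytic (f : 'rV[R]_n -> R) : Prop :=
  exists c : {ffun 'I_n -> nat} -> R,
    \forall x \near (0 : 'rV[R]_n),
      summable [set: {ffun 'I_n -> nat}] (fun a => (c a * monomial x a)%:E) /\
      power_series_box c x N @[N --> \oo] --> f x.

End AnalyticGerms.

Section Connections.
Variables (R : realType) (n : nat).

Definition vector_field := 'rV[R]_n -> 'rV[R]_n.

Implicit Types (X Y : vector_field) (f : 'rV[R]_n -> R).

Definition analytic_field X : Prop := forall k, analytic (fun x => X x 0 k).

Definition coord_field (i : 'I_n) : vector_field := fun=> delta_mx 0 i.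

Definition partial (i : 'I_n) f : 'rV[R]_n -> R :=
  fun x => 'D_(delta_mx 0 i) f x.

Definition lie_bracket X Y : vector_field :=
  fun x => 'D_(X x) Y x - 'D_(Y x) X x.

Definition operator := vector_field -> vector_field -> vector_field.

(* Only the values on analytic fields are meaningful, hence the guards.        *)
Record linear_connection (nabla : operator) : Prop := LinearConnection {
  nabla_analytic : forall X Y, analytic_field X -> analytic_field Y ->
    analytic_field (nabla X Y);
  nabla_germ : forall X X' Y Y',
    analytic_field X -> analytic_field X' ->
    analytic_field Y -> analytic_field Y' ->
    {near (0 : 'rV[R]_n), X =1 X'} -> {near (0 : 'rV[R]_n), Y =1 Y'} ->
    {near (0 : 'rV[R]_n), nabla X Y =1 nabla X' Y'};
  nablaDl : forall X X' Y,
    analytic_field X -> analytic_field X' -> analytic_field Y ->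
    \forall x \near (0 : 'rV[R]_n),
      nabla (fun y => X y + X' y) Y x = nabla X Y x + nabla X' Y x;
  nablaZl : forall f X Y,
    analytic f -> analytic_field X -> analytic_field Y ->
    \forall x \near (0 : 'rV[R]_n),
      nabla (fun y => f y *: X y) Y x = f x *: nabla X Y x;
  nablaDr : forall X Y Y',
    analytic_field X -> analytic_field Y -> analytic_field Y' ->
    \forall x \near (0 : 'rV[R]_n),
      nabla X (fun y => Y y + Y' y) x = nabla X Y x + nabla X Y' x;
  nabla_leibniz : forall f X Y,
    analytic f -> analytic_field X -> analytic_field Y ->
    \forall x \near (0 : 'rV[R]_n),
      nabla X (fun y => f y *: Y y) x =
        'D_(X x) f x *: Y x + f x *: nabla X Y x }.

Definition same_connection (nabla nabla' : operator) : Prop :=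
  forall X Y, analytic_field X -> analytic_field Y ->
    {near (0 : 'rV[R]_n), nabla X Y =1 nabla' X Y}.

(* christoffel nabla i j k is $\Gamma^k_{ij}$.                                 *)
Definition christoffel (nabla : operator) (i j k : 'I_n) : 'rV[R]_n -> R :=
  fun x => nabla (coord_field i) (coord_field j) x 0 k.

Definition torsion (nabla : operator) X Y : vector_field :=
  fun x => nabla X Y x - nabla Y X x - lie_bracket X Y x.

(* Row i of the matrix is T(\partial_i, Y) at x.                               *)
Definition tau (nabla : operator) Y : 'rV[R]_n -> R :=
  fun x => \tr (\matrix_(i < n) torsion nabla (coord_field i) Y x).

Definition tau_zero (nabla : operator) : Prop :=
  forall Y, analytic_field Y -> {near (0 : 'rV[R]_n), tau nabla Y =1 cst 0}.

(* A tensor field of type (0,2) is its matrix in the coordinate frame.         *)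
Definition tensor02 := 'rV[R]_n -> 'M[R]_n.

Definition analytic_tensor02 (r : tensor02) : Prop :=
  forall i j, analytic (fun x => r x i j).

Definition ricci (nabla : operator) : tensor02 :=
  let G := christoffel nabla in
  fun x => \matrix_(i < n, j < n)
    (\sum_(k < n) (partial k (G i j k) x - partial i (G k j k) x)
     + \sum_(k < n) \sum_(l < n)
         (G i j l x * G k l k x - G k j l x * G i l k x)).

(* The point (y, 0) of the hyperplane x^n = 0.                                 *)
Definition hyperplane_point (y : 'rV[R]_n.-1) : 'rV[R]_n :=
  \row_(i < n) (if insub (i : nat) is Some j then y 0 j else 0).

(* The germs phi and psi are the values taken at nabla by the parameters:      *)
(* phi lists Christoffel symbols selected by F, and psi lists the restrictions *)
(* to the hyperplane x^n = 0 of Christoffel symbols selected by D.             *)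
Definition has_parameters (p q : nat)
    (F : 'I_p -> 'I_n * 'I_n * 'I_n) (D : 'I_q -> 'I_n * 'I_n * 'I_n)
    (nabla : operator)
    (phi : 'I_p -> 'rV[R]_n -> R) (psi : 'I_q -> 'rV[R]_n.-1 -> R) : Prop :=
  let G s := christoffel nabla s.1.1 s.1.2 s.2 in
  (forall a, {near (0 : 'rV[R]_n), G (F a) =1 phi a}) /\
  (forall b,
     {near (0 : 'rV[R]_n.-1), G (D b) \o hyperplane_point =1 psi b}).

(* A mere bijection with the set of parameters would only compare cardinals:   *)
(* the bijection is required to be the one reading off p Christoffel symbols   *)
(* and the initial values on x^n = 0 of q Christoffel symbols.                 *)
Definition depends_bijectively (S : operator -> Prop) (p q : nat) : Prop :=
  exists (F : 'I_p -> 'I_n * 'I_n * 'I_n) (D : 'I_q -> 'I_n * 'I_n * 'I_n),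
    forall (phi : 'I_p -> 'rV[R]_n -> R) (psi : 'I_q -> 'rV[R]_n.-1 -> R),
      (forall a, analytic (phi a)) -> (forall b, analytic (psi b)) ->
      (exists nabla, S nabla /\ has_parameters F D nabla phi psi) /\
      (forall nabla nabla',
         S nabla -> has_parameters F D nabla phi psi ->
         S nabla' -> has_parameters F D nabla' phi psi ->
         same_connection nabla nabla').

End Connections.

(* Main.v *)
(* Existence and uniqueness reduce to a Cauchy-Kovalevskaya argument on jets.   *)
(* Write t for the last index and o for the first one.  The equation           *)
(* Ric(d_i, d_j) = r_ij contains d_t G^t_ij if i <> t.  For i = t the terms     *)
(* d_t G^t_tj cancel, and what is left contains - d_t G^o_oj and, apart from    *)
(* tangential derivatives, only the d_t G^k_kj with k <> o, t.  The equation    *)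
(* tau(d_j) = 0 is solved for G^t_tj if j <> t and for G^o_to if j = t.  All    *)
(* other G^k_ij are free, and the n^2 unknowns G^t_ij (i <> t), G^o_oj satisfy  *)
(* a first order system solved for their d_t, with constant coefficients in     *)
(* the tangential derivatives and a quadratic right-hand side.                  *)
(* An analytic germ is encoded by its jet, the family of its partial            *)
(* derivatives at 0 along all words of directions: the jet of a product is      *)
(* given by the Leibniz rule, differentiation is a shift, and the system        *)
(* determines the jets of the unknowns by recursion on the number of letters    *)
(* t.  Convergence follows from bounding the derivative along w by a constant   *)
(* times |w|!/(|w| + 1)^2 lam^|w| K^(number of letters t in w): this weight is  *)
(* stable under products, and each term of the right-hand side gains a factor   *)
(* 1/K, so that a large K closes the induction.                                 *)

Require Import Defs.
From mathcomp Require Import all_boot all_order all_algebra.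
From mathcomp Require Import all_classical all_reals all_analysis.
From mathcomp Require Import ring lra zify.

Set Implicit Arguments.
Unset Strict Implicit.
Unset Printing Implicit Defensive.

Import Order.TTheory GRing.Theory Num.Theory.
Import numFieldNormedType.Exports.
Local Open Scope classical_set_scope.
Local Open Scope ring_scope.

(** * Formal calculus of jets *)

(** The n^3 Christoffel symbols split into three disjoint groups. The n equations tau(d_j) = 0 are
    linear without derivatives, and each contains exactly one tau slot, with coefficient 1 or -1, so
    they eliminate n symbols ([assemble_unique]). The n^2 equations Ric = r then become a system for
    the n^2 slots, solved for their d_t ([ricci_rhsP]), whose right-hand side contains no d_t of an
    unknown ([ricci_rhs_local]). By Cauchy-Kovalevskaya it has exactly one analytic solution for
    each choice of initial values on x^t = 0. The remaining n^3 - n^2 - n symbols ([card_free]) are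
    arbitrary.

    The argument is run on jets. [analytic_taylor] and [taylor_analytic] match analytic germs with
    symmetric jets that grow at most geometrically after division by factorials. A germ determines
    its jet by [taylor_unique], and [taylorM] and [taylor_shift] translate products and derivatives.
    The abstract system is settled by [cauchy_problem_unique] and [cauchy_problem_exists]; the
    majorant hypothesis of the latter is verified in [ricci_rhs_bound]. This gives [jets_unique] and
    [jets_exist]. Finally, [connection_ofP] turns symbols into a connection, and [same_christoffel]
    shows that the symbols determine it. *)

Section BinomialConvolution.
Variable R : realType.
Implicit Types a b : nat -> R.

(** The binomial convolution, written as the Leibniz rule for an m-th derivative so that it matches
    the recursion of [jmul] letter by letter. *)
Fixpoint binconv a b (m : nat) : R :=
  if m is m'.+1 then
    binconv (fun k => a k.+1) b m' + binconv a (fun k => b k.+1) m'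
  else a 0%N * b 0%N.

(** Dividing by factorials turns the convolution into a Cauchy product. In the induction the factor
    m+1 is split as j + (m+1-j), one part for each term of the recursion. *)
Lemma binconvE a b m : binconv a b m =
  m`!%:R * \sum_(j < m.+1) (a j / j`!%:R) * (b (m - j)%N / (m - j)`!%:R).
Proof.
have fN0 k : k`!%:R != 0 :> R by rewrite pnatr_eq0 -lt0n fact_gt0.
have fS k : k.+1`!%:R = k.+1%:R * k`!%:R :> R by rewrite factS natrM.
elim: m a b => [|m IH] a b /=.
  by rewrite big_ord1 /= !fact0 !divr1 mul1r.
rewrite !{}IH -mulrDr fS -mulrA mulrCA; congr (_ * _).
have -> : \sum_(j < m.+1) a j.+1 / j`!%:R * (b (m - j)%N / (m - j)`!%:R) =
  \sum_(j < m.+2) j%:R * (a j / j`!%:R * (b (m.+1 - j)%N / (m.+1 - j)`!%:R)).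
  rewrite [RHS]big_ord_recl mul0r add0r; apply: eq_bigr => j _.
  rewrite lift0 subSS fS.
  by field; rewrite !fN0 addrC natr1 pnatr_eq0.
have -> : \sum_(j < m.+1) a j / j`!%:R * (b (m - j).+1 / (m - j)`!%:R) =
  \sum_(j < m.+2) (m.+1 - j)%:R *
    (a j / j`!%:R * (b (m.+1 - j)%N / (m.+1 - j)`!%:R)).
  rewrite [RHS]big_ord_recr /= subnn mul0r addr0; apply: eq_bigr => j _.
  rewrite subSn; last by rewrite -ltnS.
  rewrite fS.
  by field; rewrite !fN0 addrC natr1 pnatr_eq0.
rewrite -big_split mulr_sumr; apply: eq_bigr => j _ /=.
by rewrite -mulrDl -natrD subnKC // -ltnS.
Qed.

Lemma binconvC a b : binconv a b =1 binconv b a.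
Proof.
move=> m; elim: m a b => [|m IH] a b /=; first by rewrite mulrC.
by rewrite IH [in X in _ + X]IH addrC.
Qed.

Lemma binconv_suml I (s : seq I) (c : I -> R) (A : I -> nat -> R) b m :
  binconv (fun k => \sum_(i <- s) c i * A i k) b m =
  \sum_(i <- s) c i * binconv (A i) b m.
Proof.
elim: m A b => [|m IH] A b /=.
  by rewrite mulr_suml; apply: eq_bigr => i _; rewrite mulrA.
by rewrite !IH -big_split; apply: eq_bigr => i _; rewrite mulrDr.
Qed.

Lemma binconv_sumr I (s : seq I) (c : I -> R) (B : I -> nat -> R) a m :
  binconv a (fun k => \sum_(i <- s) c i * B i k) m =
  \sum_(i <- s) c i * binconv a (B i) m.
Proof.
by rewrite binconvC binconv_suml; apply: eq_bigr => i _; rewrite binconvC.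
Qed.

Lemma binconvZl c a b m : binconv (fun k => c * a k) b m = c * binconv a b m.
Proof.
by elim: m a b => [|m IH] a b /=; rewrite ?mulrA // !IH mulrDr.
Qed.

Lemma binconvZr c a b m : binconv a (fun k => c * b k) m = c * binconv a b m.
Proof. by rewrite binconvC binconvZl binconvC. Qed.

End BinomialConvolution.

(** * Jets indexed by words, and their homogeneous Taylor terms *)

Section Jets.
Variables (R : realType) (n : nat).

(* The jet of f at 0 lists the iterated partial derivatives of f at 0 along    *)
(* all words of directions.                                                    *)
Definition jet := seq 'I_n -> R.

Implicit Types (V W : jet) (w : seq 'I_n) (x h : 'rV[R]_n).

Definition jshift (i : 'I_n) V : jet := fun w => V (i :: w).

(* Leibniz rule: this is the shuffle product.                                  *)
Fixpoint jmul V W w : R :=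
  if w is i :: w' then jmul (jshift i V) W w' + jmul V (jshift i W) w'
  else V [::] * W [::].

(** Partial derivatives commute, so only such jets can come from functions. *)
Definition symmetric_jet V := forall w w', perm_eq w w' -> V w = V w'.

(* hom m V x / m! is the term of degree m of the Taylor expansion at 0 of a    *)
(* function with jet V.                                                        *)
Fixpoint hom (m : nat) V x : R :=
  if m is m'.+1 then \sum_(i < n) x 0 i * hom m' (jshift i V) x else V [::].

Definition l1 x : R := \sum_(i < n) `|x 0 i|.

Definition jet_bounded (M l : R) V := forall w, `|V w| <= M * (size w)`!%:R * l ^+ size w.

Lemma symmetric_shift i V : symmetric_jet V -> symmetric_jet (jshift i V).
Proof. by move=> sV w w' pw; apply: sV; rewrite perm_cons. Qed.

Lemma jshiftC i j V : symmetric_jet V ->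
  jshift i (jshift j V) = jshift j (jshift i V).
Proof.
move=> sV; apply: funext => w; apply: sV.
exact: permEl (perm_catCA [:: j] [:: i] w).
Qed.

(** Since shifts of symmetric jets commute, any letter can be moved to the front of the word
    ([front]); an induction then strips common letters. *)
Lemma jmul_symmetric V W : symmetric_jet V -> symmetric_jet W ->
  symmetric_jet (jmul V W).
Proof.
have front i u v : forall V W, symmetric_jet V -> symmetric_jet W ->
    jmul V W (u ++ i :: v) = jmul V W (i :: u ++ v).
  elim: u => [//|j u IH] {}V {}W sV sW /=.
  rewrite !IH //; try exact: symmetric_shift.
  by rewrite /= (jshiftC j i sV) (jshiftC j i sW) addrACA.
move=> sV sW w; elim: w V W sV sW => [|i w IH] V W sV sW w' pw.
  by move: pw => /perm_size /esym /size0nil ->.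
have iw' : i \in w' by rewrite -(perm_mem pw) mem_head.
case/splitPr: iw' pw => u v pw; rewrite front //=.
have pw' : perm_eq w (u ++ v).
  rewrite -(perm_cons i); apply: (perm_trans pw).
  exact: permEl (perm_catCA u [:: i] v).
by congr (_ + _); apply: IH => //; exact: symmetric_shift.
Qed.

(** The weight of a word is multiplicative in its letters, so only the dependence on the length is
    convolved. *)
Lemma le_jmul (al be : nat -> R) (l : 'I_n -> R) V W :
  (forall i, 0 <= l i) ->
  (forall w, `|V w| <= al (size w) * \prod_(i <- w) l i) ->
  (forall w, `|W w| <= be (size w) * \prod_(i <- w) l i) ->
  forall w, `|jmul V W w| <= binconv al be (size w) * \prod_(i <- w) l i.
Proof.
move=> l0 hV hW w; elim: w al be V W hV hW => [|i w IH] al be V W hV hW /=.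
  have := hV [::]; have := hW [::]; rewrite /= !big_nil !mulr1 normrM => h1 h2.
  exact: ler_pM.
rewrite big_cons (le_trans (ler_normD _ _)) // mulrDl lerD //.
- rewrite mulrCA mulrA -binconvZl; apply: IH => // v.
  by have := hV (i :: v); rewrite /= big_cons mulrCA mulrA.
- rewrite mulrCA mulrA -binconvZr; apply: IH => // v.
  by have := hW (i :: v); rewrite /= big_cons mulrCA mulrA.
Qed.

Lemma hom_sum I (s : seq I) (c : I -> R) (A : I -> jet) m x :
  hom m (fun w => \sum_(i <- s) c i * A i w) x =
  \sum_(i <- s) c i * hom m (A i) x.
Proof.
elim: m A => [//|m IH] A /=.
under eq_bigr do rewrite (IH (fun k => jshift _ (A k))) mulr_sumr.
rewrite exchange_big; apply: eq_bigr => k _ /=.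
by rewrite mulr_sumr; apply: eq_bigr => i _; rewrite mulrCA.
Qed.

Lemma homD m V W x : hom m (fun w => V w + W w) x = hom m V x + hom m W x.
Proof.
elim: m V W => [//|m IH] V W /=; rewrite -big_split.
by apply: eq_bigr => i _ /=; rewrite (IH (jshift i V) (jshift i W)) mulrDr.
Qed.

(** Contracting every letter with x turns the Leibniz rule over words into the one-variable one. *)
Lemma hom_mul m V W x :
  hom m (jmul V W) x = binconv (fun k => hom k V x) (fun k => hom k W x) m.
Proof.
elim: m V W => [//|m IH] V W.
have -> : hom m.+1 (jmul V W) x = \sum_(i < n) x 0 i *
    (hom m (jmul (jshift i V) W) x + hom m (jmul V (jshift i W)) x).
  by apply: eq_bigr => i _; rewrite -homD.
under eq_bigr do rewrite !IH mulrDr.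
by rewrite big_split /= -binconv_suml -binconv_sumr.
Qed.

Lemma l1_ge0 x : 0 <= l1 x.
Proof. exact: sumr_ge0. Qed.

Lemma l1D x y : l1 (x + y) <= l1 x + l1 y.
Proof. by rewrite -big_split ler_sum // => i _; rewrite mxE ler_normD. Qed.

Lemma l1Z c x : l1 (c *: x) = `|c| * l1 x.
Proof. by rewrite mulr_sumr; apply: eq_bigr => i _; rewrite mxE normrM. Qed.

Lemma le_hom m V x A : (forall w, size w = m -> `|V w| <= A) ->
  `|hom m V x| <= A * l1 x ^+ m.
Proof.
elim: m V => [|m IH] V hV /=; first by rewrite mulr1 hV.
apply: (le_trans (ler_norm_sum _ _ _)).
rewrite exprSr mulrA mulr_sumr ler_sum // => i _.
rewrite normrM mulrC ler_wpM2r // IH // => w sw.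
by apply: hV => /=; rewrite sw.
Qed.

(** Mean value estimate by induction on the degree. The base 4d leaves room for l1 (x + h) <= 2d and
    for the two terms produced at each step. *)
Lemma hom_diff_bound m V x h A (d : R) :
  l1 x <= d -> l1 h <= d -> 0 < d -> 0 <= A ->
  (forall w, size w = m -> `|V w| <= A) ->
  `|hom m V (x + h) - hom m V x| <= A * l1 h * (4 * d) ^+ m / d.
Proof.
move=> xd hd d0 A0; elim: m V => [|m IH] V hV /=.
  by rewrite subrr normr0 mulr_ge0 ?invr_ge0 ?(ltW d0) // expr0 mulr1
    mulr_ge0 ?l1_ge0.
have hs i w : size w = m -> `|jshift i V w| <= A.
  by move=> sw; apply: hV => /=; rewrite sw.
have -> : \sum_(i < n) (x + h) 0 i * hom m (jshift i V) (x + h)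
    - \sum_(i < n) x 0 i * hom m (jshift i V) x =
  \sum_(i < n) x 0 i * (hom m (jshift i V) (x + h) - hom m (jshift i V) x)
  + \sum_(i < n) h 0 i * hom m (jshift i V) (x + h).
  by rewrite -sumrB -big_split; apply: eq_bigr => i _ /=; rewrite mxE; ring.
have P0 : 0 <= (4 * d) ^+ m by rewrite exprn_ge0 // mulr_ge0 // ltW.
have e1 : `|\sum_(i < n) x 0 i * (hom m (jshift i V) (x + h) - hom m (jshift i V) x)|
   <= l1 x * (A * l1 h * (4 * d) ^+ m / d).
  apply: (le_trans (ler_norm_sum _ _ _)); rewrite mulr_suml ler_sum // => i _.
  by rewrite normrM ler_wpM2l // IH // => w; exact: hs.
have e2 : `|\sum_(i < n) h 0 i * hom m (jshift i V) (x + h)|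
   <= l1 h * (A * (4 * d) ^+ m).
  apply: (le_trans (ler_norm_sum _ _ _)); rewrite mulr_suml ler_sum // => i _.
  rewrite normrM ler_wpM2l // (le_trans (le_hom _ (hs i))) // ler_wpM2l //.
  rewrite lerXn2r ?nnegrE ?l1_ge0 ?mulr_ge0 ?(ltW d0) //.
  by have := l1D x h; lra.
apply: (le_trans (ler_normD _ _)); apply: (le_trans (lerD e1 e2)).
set P := _ ^+ m in P0 *; rewrite exprS -/P.
have -> : A * l1 h * (4 * d * P) / d = A * l1 h * P * 4.
  by field; rewrite gt_eqF.
have AhP : 0 <= A * l1 h * P by rewrite !mulr_ge0 ?l1_ge0.
have : l1 x * (A * l1 h * P / d) <= A * l1 h * P.
  by rewrite mulrCA ler_piMr // ler_pdivrMr // mul1r.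
by move=> le1; apply: le_trans (lerD le1 (lexx _)) _; nra.
Qed.

(* The derivative of hom m V at x along h when V is symmetric.                 *)
Definition dhom m V x h : R :=
  if m is m'.+1 then m%:R * \sum_(i < n) h 0 i * hom m' (jshift i V) x else 0.

(** The same induction one order higher, with [hom_diff_bound] controlling the new cross term. *)
Lemma hom_taylor2 m V x h A (d : R) :
  l1 x <= d -> l1 h <= d -> 0 < d -> 0 <= A -> symmetric_jet V ->
  (forall w, size w = m -> `|V w| <= A) ->
  `|hom m V (x + h) - hom m V x - dhom m V x h| <=
  A * l1 h ^+ 2 * (8 * d) ^+ m / d ^+ 2.
Proof.
move=> xd hd d0 A0; elim: m V => [|m IH] V sV hV.
  rewrite /= subrr subr0 normr0 mulr_ge0 ?invr_ge0 ?exprn_ge0 ?(ltW d0) //.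
  by rewrite expr0 mulr1 mulr_ge0 ?exprn_ge0 ?l1_ge0.
have hs i w : size w = m -> `|jshift i V w| <= A.
  by move=> sw; apply: hV => /=; rewrite sw.
(* By symmetry the two contractions can be exchanged. The inner letters contribute m equal terms and
   the outer letter one more, which makes the factor m+1 of [dhom]. *)
have dS : \sum_(i < n) x 0 i * dhom m (jshift i V) x h =
    m%:R * \sum_(i < n) h 0 i * hom m (jshift i V) x.
  case: m {IH hV hs} => [|m]; first by rewrite mul0r big1 // => i _; rewrite mulr0.
  under eq_bigr do rewrite /= mulrCA mulr_sumr.
  rewrite -mulr_sumr exchange_big /=; congr (_ * _); apply: eq_bigr => i _.
  rewrite mulr_sumr; apply: eq_bigr => j _.
  by rewrite mulrCA (jshiftC i j sV).
have -> : hom m.+1 V (x + h) - hom m.+1 V x - dhom m.+1 V x h =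
  \sum_(i < n) x 0 i * (hom m (jshift i V) (x + h) - hom m (jshift i V) x
     - dhom m (jshift i V) x h)
  + \sum_(i < n) h 0 i * (hom m (jshift i V) (x + h) - hom m (jshift i V) x).
  under [in RHS]eq_bigr do rewrite mulrBr.
  rewrite sumrB dS /= mulr_sumr mulr_sumr -!sumrB -big_split.
  by apply: eq_bigr => i _ /=; rewrite mxE -natr1; ring.
have P0 : 0 <= (8 * d) ^+ m by rewrite exprn_ge0 // mulr_ge0 // ltW.
have e1 : `|\sum_(i < n) x 0 i * (hom m (jshift i V) (x + h) - hom m (jshift i V) x
     - dhom m (jshift i V) x h)|
   <= l1 x * (A * l1 h ^+ 2 * (8 * d) ^+ m / d ^+ 2).
  apply: (le_trans (ler_norm_sum _ _ _)); rewrite mulr_suml ler_sum // => i _.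
  rewrite normrM ler_wpM2l // IH //; first exact: symmetric_shift.
  exact: hs.
have e2 : `|\sum_(i < n) h 0 i * (hom m (jshift i V) (x + h) - hom m (jshift i V) x)|
   <= l1 h * (A * l1 h * (8 * d) ^+ m / d).
  apply: (le_trans (ler_norm_sum _ _ _)); rewrite mulr_suml ler_sum // => i _.
  rewrite normrM ler_wpM2l // (le_trans (hom_diff_bound xd hd d0 A0 (hs i))) //.
  rewrite ler_wpM2r ?invr_ge0 ?(ltW d0) // ler_wpM2l ?mulr_ge0 ?l1_ge0 //.
  rewrite lerXn2r ?nnegrE ?mulr_ge0 ?(ltW d0) //.
  by rewrite ler_wpM2r ?(ltW d0) // ler_nat.
apply: (le_trans (ler_normD _ _)); apply: (le_trans (lerD e1 e2)).
set P := _ ^+ m in P0 *; rewrite [(8 * d) ^+ _]exprS -/P.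
have -> : A * l1 h ^+ 2 * (8 * d * P) / d ^+ 2 = A * l1 h ^+ 2 * P / d * 8.
  by field; rewrite gt_eqF.
have AhP : 0 <= A * l1 h ^+ 2 * P / d.
  by rewrite divr_ge0 ?(ltW d0) // !mulr_ge0 // l1_ge0.
have -> : l1 h * (A * l1 h * P / d) = A * l1 h ^+ 2 * P / d by rewrite expr2; ring.
have : l1 x * (A * l1 h ^+ 2 * P / d ^+ 2) <= A * l1 h ^+ 2 * P / d.
  have -> : l1 x * (A * l1 h ^+ 2 * P / d ^+ 2) =
     (A * l1 h ^+ 2 * P / d) * (l1 x / d) by field; rewrite gt_eqF.
  by rewrite ler_piMr // ler_pdivrMr // mul1r.
by move=> le1; apply: le_trans (lerD le1 (lexx _)) _; nra.
Qed.

End Jets.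

(** * Taylor series of jets *)

Section TaylorSeries.
Variables (R : realType) (n : nat).
Implicit Types (V W : jet R n) (x h v : 'rV[R]_n) (f g : 'rV[R]_n -> R).

Lemma geometric_dominated (u : R^nat) M :
  (forall m, `|u m| <= M * (1 / 2) ^+ m) ->
  cvgn (series u) /\ (forall N, `|series u N| <= 2 * M).
Proof.
move=> hu; have M0 : 0 <= M.
  by have := hu 0%N; rewrite expr0 mulr1; apply: le_trans.
have h12 : `|1 / 2 : R| < 1 by rewrite ger0_norm; lra.
have g0 m : 0 <= geometric M (1 / 2) m by apply: geometric_ge0 => //; lra.
split.
  apply: normed_cvg; apply: (series_le_cvg _ g0 hu) => //.
  exact: is_cvg_geometric_series.
move=> N; apply: (@le_trans _ _ (series (geometric M (1 / 2)) N)).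
  rewrite /series /=; apply: (le_trans (ler_norm_sum _ _ _)).
  by apply: ler_sum => i _; exact: hu.
rewrite geometric_seriesE /=; last by lra.
have : 0 <= (1 / 2 : R) ^+ N by apply: exprn_ge0; lra.
move: ((1 / 2) ^+ N) => t t0.
have -> : M * (1 - t) / (1 - 1 / 2) = 2 * M - 2 * (M * t) by field.
by rewrite gerBl mulr_ge0 // mulr_ge0.
Qed.

Lemma near_l1 (d : R) : 0 < d -> \forall x \near (0 : 'rV[R]_n), l1 x < d.
Proof.
move=> d0; have e0 : 0 < d / n.+1%:R by rewrite divr_gt0.
apply: filterS (nbhs0_lt e0) => x xe.
apply: (@le_lt_trans _ _ (\sum_(i < n) `|x|)).
  by apply: ler_sum => i _; rewrite [leRHS]/Num.Def.normr /= mx_normrE;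
    apply/bigmax_geP; right => /=; exists (0, i).
rewrite sumr_const card_ord -mulr_natr.
have := xe; rewrite ltr_pdivlMr // => /(le_lt_trans _); apply.
by rewrite ler_wpM2l // ler_nat.
Qed.

Definition taylor_sum V x : R^nat := series (fun m => hom m V x / m`!%:R).

(** Where the series diverges [limn] gives a default value; only values near 0 are used. *)
Definition ev V x : R := limn (taylor_sum V x).

Definition exp_bounded V := exists M l : R,
  [/\ 0 <= M, 1 <= l & jet_bounded M l V].

(** The interface between germs and jets. The growth bound is built in because products and termwise
    differentiation rely on it. *)
Definition taylor V f := [/\ symmetric_jet V, exp_bounded V &
  \forall x \near (0 : 'rV[R]_n), taylor_sum V x @ \oo --> f x].

Lemma fact_gt0R m : 0 < m`!%:R :> R.
Proof. by rewrite ltr0n fact_gt0. Qed.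

Lemma taylor_term_bound M l V x m : 0 <= M -> 0 <= l -> jet_bounded M l V ->
  l1 x * l <= 1 / 2 -> `|hom m V x / m`!%:R| <= M * (1 / 2) ^+ m.
Proof.
move=> M0 l0 bV xl; rewrite normrM normfV [`|_%:R|]gtr0_norm ?fact_gt0R //.
rewrite ler_pdivrMr ?fact_gt0R //.
apply: le_trans (@le_hom _ _ m V x (M * m`!%:R * l ^+ m) _) _.
  by move=> w <-; exact: bV.
rewrite -mulrA -exprMn mulrAC ler_wpM2r // ler_wpM2l //.
by rewrite mulrC lerXn2r ?nnegrE ?mulr_ge0 ?l1_ge0.
Qed.

Lemma taylor_sum_cvg M l V x : 0 <= M -> 0 <= l -> jet_bounded M l V ->
  l1 x * l <= 1 / 2 -> taylor_sum V x @ \oo --> ev V x.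
Proof.
move=> M0 l0 bV xl.
by have [] := geometric_dominated (fun m => taylor_term_bound m M0 l0 bV xl).
Qed.

(** The factor m+1 gained from the factorial is absorbed by 2^m. *)
Lemma exp_bounded_shift M l V i : 0 <= M -> 0 <= l -> jet_bounded M l V ->
  jet_bounded (M * l) (2 * l) (jshift i V).
Proof.
move=> M0 l0 bV w; apply: le_trans (bV (i :: w)) _ => /=.
rewrite factS natrM exprS exprMn.
set F := _`!%:R; set L := l ^+ _.
have L0 : 0 <= L by rewrite exprn_ge0.
have F0 : 0 <= F by rewrite ler0n.
have -> : M * ((size w).+1%:R * F) * (l * L) = M * l * F * L * (size w).+1%:R.
  by ring.
have -> : M * l * F * (2 ^+ size w * L) = M * l * F * L * 2 ^+ size w by ring.
rewrite ler_wpM2l ?mulr_ge0 //.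
by rewrite -natrX ler_nat; exact: ltn_expl.
Qed.

Lemma near_exp_bounded l (c : R) : 1 <= l -> 0 < c ->
  \forall x \near (0 : 'rV[R]_n), l1 x * l <= c.
Proof.
move=> l1' c0; have l0 : 0 < l by apply: lt_le_trans l1'.
have := @near_l1 (c / l) (divr_gt0 c0 l0).
by apply: filterS => x /ltW; rewrite ler_pdivlMr.
Qed.

Lemma ev_taylor V : symmetric_jet V -> exp_bounded V -> taylor V (ev V).
Proof.
move=> sV bV; split=> //; case: bV => M [l [M0 l1' bV]].
apply: filterS (near_exp_bounded l1' (divr_gt0 ltr01 (ltr0Sn R 1))) => x xl.
by apply: (taylor_sum_cvg M0 _ bV xl); apply: le_trans l1'.
Qed.

Lemma near_ev V f : taylor V f -> \forall x \near (0 : 'rV[R]_n), f x = ev V x.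
Proof.
case=> sV bV; apply: filterS => x fx.
by apply/esym/cvg_lim.
Qed.

Lemma near_taylor V f g : taylor V f ->
  (\forall x \near (0 : 'rV[R]_n), f x = g x) -> taylor V g.
Proof. by case=> sV bV; move=> h1 h2; split=> //; apply: filterS2 h1 h2 => x + <-. Qed.

(** Sums [hom_taylor2] over all degrees: 16 d l <= 1 makes the ratio 8 d l at most 1/2. The
    quadratic remainder then yields the derivative in [is_derive_ev]. *)
Lemma ev_taylor2 M l V x h (d : R) : 0 <= M -> 1 <= l -> symmetric_jet V ->
  jet_bounded M l V -> 0 < d -> 16 * d * l <= 1 -> l1 x <= d -> l1 h <= d ->
  `|ev V (x + h) - ev V x - \sum_(i < n) h 0 i * ev (jshift i V) x|
   <= 2 * (M / d ^+ 2) * l1 h ^+ 2.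
Proof.
move=> M0 l1' sV bV d0 dl xd hd; have l0 : 0 <= l by apply: le_trans l1'.
have dl0 : 0 <= d * l by rewrite mulr_ge0 // ltW.
have h1 y : l1 y <= 2 * d -> l1 y * l <= 1 / 2.
  move=> yd; apply: (@le_trans _ _ (2 * d * l)); first by rewrite ler_wpM2r.
  by lra.
have cx : taylor_sum V x @ \oo --> ev V x.
  by apply: (taylor_sum_cvg M0 l0 bV); apply: h1; lra.
have cxh : taylor_sum V (x + h) @ \oo --> ev V (x + h).
  by apply: (taylor_sum_cvg M0 l0 bV); apply: h1; have := l1D x h; lra.
have ci i : taylor_sum (jshift i V) x @ \oo --> ev (jshift i V) x.
  apply: (taylor_sum_cvg _ _ (exp_bounded_shift i M0 l0 bV)); rewrite ?mulr_ge0 //.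
  have : l1 x * l <= d * l by rewrite ler_wpM2r.
  by lra.
(* Differentiation lowers the degree by one, hence N+1 terms of the series against N terms of the
   shifted ones. *)
pose u N := taylor_sum V (x + h) N.+1 - taylor_sum V x N.+1
   - \sum_(i < n) h 0 i * taylor_sum (jshift i V) x N.
have cu : u @ \oo --> ev V (x + h) - ev V x - \sum_(i < n) h 0 i * ev (jshift i V) x.
  apply: cvgB; first by apply: cvgB; rewrite cvg_shiftS.
  apply: (cvg_big add_continuous) => i _; apply: cvgMl_tmp; exact: ci.
suff hu : forall N, `|u N| <= 2 * (M / d ^+ 2) * l1 h ^+ 2.
  apply: (cvgr_to_le (cvg_norm cu)).
  by apply: nearW => N; exact: hu.
move=> N.
pose r m := (hom m V (x + h) - hom m V x - dhom m V x h) / m`!%:R.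
have -> : u N = series r N.+1.
  rewrite /u /taylor_sum /series /= -sumrB.
  rewrite [RHS](_ : _ = \sum_(0 <= k < N.+1) (hom k V (x + h) / k`!%:R
       - hom k V x / k`!%:R) - \sum_(0 <= k < N.+1) dhom k V x h / k`!%:R).
    congr (_ - _); rewrite [RHS]big_nat_recl //= mul0r add0r.
    under [LHS]eq_bigr do rewrite mulr_sumr.
    rewrite exchange_big /=; apply: eq_bigr => k _.
    rewrite factS natrM mulr_sumr mulr_suml; apply: eq_bigr => i _.
    have := fact_gt0R k; move: (k`!%:R) => F F0.
    by field; rewrite gt_eqF //= addrC natr1 pnatr_eq0.
  by rewrite -sumrB; apply: eq_bigr => k _; rewrite /r !mulrBl.
rewrite mulrAC -mulrA.
have [|_] := @geometric_dominated r (l1 h ^+ 2 * (M / d ^+ 2)); last first.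
  by move/(_ N.+1); congr (_ <= _); ring.
move=> m; rewrite /r normrM normfV [`|_%:R|]gtr0_norm ?fact_gt0R //.
rewrite ler_pdivrMr ?fact_gt0R //.
apply: le_trans (@hom_taylor2 _ _ m V x h (M * m`!%:R * l ^+ m) d xd hd d0 _ sV _) _.
- by rewrite !mulr_ge0 ?exprn_ge0.
- by move=> w <-; exact: bV.
have -> : M * m`!%:R * l ^+ m * l1 h ^+ 2 * (8 * d) ^+ m / d ^+ 2 =
   l1 h ^+ 2 * (M / d ^+ 2) * m`!%:R * (l * (8 * d)) ^+ m.
  by rewrite [(l * _) ^+ m]exprMn; field; rewrite gt_eqF.
rewrite [leRHS]mulrAC ler_wpM2l //.
  by rewrite !mulr_ge0 ?exprn_ge0 ?invr_ge0 ?exprn_ge0 ?l1_ge0 // ltW.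
by rewrite lerXn2r ?nnegrE ?mulr_ge0 ?(ltW d0) //; lra.
Qed.

Lemma is_derive_ev M l V x v : 0 <= M -> 1 <= l -> symmetric_jet V ->
  jet_bounded M l V -> l1 x * l <= 1 / 16 ->
  is_derive x v (ev V) (\sum_(i < n) v 0 i * ev (jshift i V) x).
Proof.
move=> M0 l1' sV bV xl; have l0 : 0 < l by apply: lt_le_trans l1'.
pose d := 1 / 16 / l; have d0 : 0 < d by rewrite divr_gt0 //; lra.
have dl : 16 * d * l <= 1 by rewrite /d mulrA mulfVK ?gt_eqF //; lra.
have xd : l1 x <= d by rewrite ler_pdivlMr.
set L := \sum_(i < n) _.
suff c : h^-1 *: ((ev V \o shift x) (h *: v) - ev V x) @[h --> 0^'] --> L.
  by split; [apply/cvg_ex; exists L|apply/cvg_lim].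
pose C := 2 * (M / d ^+ 2) * l1 v ^+ 2.
have C0 : 0 <= C.
  by rewrite !mulr_ge0 ?invr_ge0 ?exprn_ge0 ?l1_ge0 // ltW.
apply/cvgrPdist_le => e e0; near=> t.
have t0 : t != 0 by near: t; exact: nbhs_dnbhs_neq.
have td : l1 (t *: v) <= d.
  rewrite l1Z; have : `|t| <= d / (l1 v + 1).
    by near: t; apply: dnbhs0_le; rewrite divr_gt0 // ltr_wpDl ?l1_ge0.
  rewrite ler_pdivlMr ?ltr_wpDl ?l1_ge0 //; apply: le_trans.
  by rewrite ler_wpM2l // lerDl.
have te : `|t| * C <= e.
  have : `|t| <= e / (C + 1).
    by near: t; apply: dnbhs0_le; rewrite divr_gt0 // ltr_wpDl.
  rewrite ler_pdivlMr ?ltr_wpDl //; apply: le_trans.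
  by rewrite ler_wpM2l // lerDl.
have := ev_taylor2 M0 l1' sV bV d0 dl xd td.
have -> : \sum_(i < n) (t *: v) 0 i * ev (jshift i V) x = t * L.
  by rewrite mulr_sumr; apply: eq_bigr => i _; rewrite mxE mulrA.
rewrite l1Z [(`|t| * _) ^+ 2]exprMn => bnd.
rewrite /= distrC.
have -> : t^-1 *: (ev V (t *: v + x) - ev V x) - L =
    t^-1 * (ev V (x + t *: v) - ev V x - t * L).
  rewrite -[LHS]/(t^-1 * (ev V (t *: v + x) - ev V x) - L) [t *: v + x]addrC.
  by move: (L) (ev V (x + _)) (ev V x) => a b c; field.
rewrite normrM normfV ler_pdivrMl ?normr_gt0 //.
apply: le_trans bnd _; apply: (@le_trans _ _ (`|t| * (`|t| * C))).
  by rewrite /C le_eqVlt; apply/orP; left; apply/eqP; ring.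
by rewrite ler_wpM2l.
Unshelve. all: by end_near. Qed.

Lemma taylor_is_derive V f : taylor V f -> \forall x \near (0 : 'rV[R]_n),
  forall v, is_derive x v f (\sum_(i < n) v 0 i * ev (jshift i V) x).
Proof.
move=> tV; have [sV [M [l [M0 l1' bV]]] _] := tV.
have xl := @near_exp_bounded l (1 / 16) l1' (divr_gt0 ltr01 (ltr0Sn R 15)).
apply: filterS2 xl (near_join (near_ev tV)) => x xl fx v.
apply: near_eq_is_derive (is_derive_ev v M0 l1' sV bV xl).
by apply: filterS fx => y ->.
Qed.

Lemma taylor_shift i V f : taylor V f -> taylor (jshift i V) (partial i f).
Proof.
move=> tV; have [sV [M [l [M0 l1' bV]]] _] := tV.
have bs : exp_bounded (jshift i V).
  exists (M * l), (2 * l); split; [|lra|].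
    by rewrite mulr_ge0 // (le_trans _ l1').
  by apply: exp_bounded_shift => //; apply: le_trans l1'.
apply: near_taylor (ev_taylor (symmetric_shift i sV) bs) _.
apply: filterS (taylor_is_derive tV) => x /(_ (delta_mx 0 i)) [_ e].
rewrite /partial e (bigD1 i) //= mxE !eqxx mul1r big1 ?addr0 // => j ji.
by rewrite mxE eqxx (negbTE ji) mul0r.
Qed.

Lemma taylor_derive V f : taylor V f -> \forall x \near (0 : 'rV[R]_n),
  forall v, derivable f x v /\ 'D_v f x = \sum_(i < n) v 0 i * partial i f x.
Proof.
move=> tV.
have ni : \forall x \near (0 : 'rV[R]_n), forall i, partial i f x = ev (jshift i V) x.
  have h i := near_ev (taylor_shift i tV).
  exact: filter_forall h.
apply: filterS2 (taylor_is_derive tV) ni => x dx px v.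
by have [? ->] := dx v; split=> //; apply: eq_bigr => i _; rewrite px.
Qed.

(** The entry at w is an iterated partial derivative at 0: [taylor_shift] peels off the letters, and
    the entry at the empty word is the value at 0. *)
Lemma taylor_unique V W f : taylor V f -> taylor W f -> V = W.
Proof.
move=> tV tW; apply: funext => w.
elim: w f V W tV tW => [|i w IH] f V W tV tW; last first.
  exact: IH (taylor_shift i tV) (taylor_shift i tW).
have v0 U g : taylor U g -> U [::] = g 0.
  case=> _ _ /nbhs_singleton /(cvg_lim (@Rhausdorff R)) <-.
  apply/esym/cvg_lim => //; apply: (@cvg_near_cst _ _ (U [::])).
  exists 1%N => // N /= N1.
  rewrite /taylor_sum /series /= big_ltn //= big_nat big1 ?addr0 ?divr1 //.
  move=> [//|m] _ /=; rewrite big1 ?mul0r // => j _; by rewrite mxE mul0r.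
by rewrite (v0 _ _ tV) (v0 _ _ tW).
Qed.

End TaylorSeries.

(** * Operations on Taylor series *)

Section TaylorClosure.
Variables (R : realType) (n : nat).
Implicit Types (V W : jet R n) (x : 'rV[R]_n) (f g : 'rV[R]_n -> R).

Lemma jet_bounded_le M l M' l' V : 0 <= M -> 0 <= l -> M <= M' -> l <= l' ->
  jet_bounded M l V -> jet_bounded M' l' V.
Proof.
move=> M0 l0 MM ll bV w; apply: le_trans (bV w) _.
apply: ler_pM; rewrite ?mulr_ge0 ?exprn_ge0 ?ler_wpM2r //.
by rewrite lerXn2r ?nnegrE // (le_trans l0).
Qed.

(** Summing the constants over the finite index type gives common ones. *)
Lemma exp_bounded_family (I : finType) (V : I -> jet R n) :
  (forall i, exp_bounded (V i)) ->
  exists M l : R, [/\ 0 <= M, 1 <= l & forall i, jet_bounded M l (V i)].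
Proof.
move=> /(_ _)/cid hV.
have {}hV i : {Ml : R * R | [/\ 0 <= Ml.1, 1 <= Ml.2 & jet_bounded Ml.1 Ml.2 (V i)]}.
  by case: (hV i) => M /cid [l h]; exists (M, l).
pose M := \sum_i (sval (hV i)).1; pose l := 1 + \sum_i (sval (hV i)).2.
have p1 i : 0 <= (sval (hV i)).1 by case: (hV i) => ? [].
have p2 i : 0 <= (sval (hV i)).2 by case: (hV i) => ? [/= _ /(le_trans ler01)].
exists M, l; split=> [||i]; rewrite ?sumr_ge0 ?lerDl ?sumr_ge0 //.
apply: (@jet_bounded_le (sval (hV i)).1 (sval (hV i)).2) => //.
- by rewrite /M (bigD1 i) //= lerDl sumr_ge0.
- by rewrite /l (bigD1 i) //= addrCA lerDl addr_ge0 ?sumr_ge0.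
- by case: (hV i) => ? [].
Qed.

Lemma exp_bounded2 V W : exp_bounded V -> exp_bounded W ->
  exists M l : R, [/\ 0 <= M, 1 <= l, jet_bounded M l V & jet_bounded M l W].
Proof.
move=> bV bW; have [|M [l [M0 l1' h]]] := @exp_bounded_family bool (fun b => if b then V else W).
  by case.
by exists M, l; split=> //; [exact: (h true)|exact: (h false)].
Qed.

Definition jet_cst (c : R) : jet R n := fun w => if w is [::] then c else 0.

Lemma taylor_cst c : taylor (jet_cst c) (cst c).
Proof.
split.
- by move=> [|i w] [|j w'] // /perm_size.
- exists `|c|, 1; split=> // -[|i w] /=; rewrite ?fact0 ?expr1n ?mulr1 //.
  by rewrite normr0 mulr_ge0.
near=> x; apply: (@cvg_near_cst _ _ c); exists 1%N => // N /= N1.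
rewrite /taylor_sum /series /= big_ltn //= big_nat big1 ?addr0 ?divr1 //.
have h m : hom m (fun=> 0 : R) x = 0.
  elim: m => [//|m IH] /=; apply: big1 => j _.
  by rewrite -[X in _ * X]/(hom m (fun=> 0) x) IH mulr0.
move=> [//|m] _ /=; rewrite big1 ?mul0r // => j _.
by rewrite -[X in _ * X]/(hom m (fun=> 0) x) h mulr0.
Unshelve. all: by end_near. Qed.

Lemma taylorD V W f g : taylor V f -> taylor W g ->
  taylor (fun w => V w + W w) (fun x => f x + g x).
Proof.
move=> [sV bV cV] [sW bW cW]; split.
- by move=> w w' p; rewrite (sV _ _ p) (sW _ _ p).
- have [M [l [M0 l1' hV hW]]] := exp_bounded2 bV bW.
  exists (M + M), l; split=> [||w] //; first exact: addr_ge0.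
  by rewrite !mulrDl (le_trans (ler_normD _ _)) // lerD.
apply: filterS2 cV cW => x fx gx.
have -> : taylor_sum (fun w => V w + W w) x = taylor_sum V x + taylor_sum W x.
  apply/funext => N; rewrite /taylor_sum /series /= fctE -big_split.
  by apply: eq_bigr => m _; rewrite homD mulrDl.
exact: cvgD.
Qed.

(** The Cauchy product consists of m+1 equal terms, and m+1 <= 2^m. *)
Lemma jmul_bounded M l V W : 0 <= M -> 0 <= l -> jet_bounded M l V ->
  jet_bounded M l W -> jet_bounded (M * M) (2 * l) (jmul V W).
Proof.
move=> M0 l0 bV bW w.
have p1 (v : seq 'I_n) : \prod_(i <- v) (1 : R) = 1 by exact: big1_eq.
have := @le_jmul _ _ (fun m => M * m`!%:R * l ^+ m) (fun m => M * m`!%:R * l ^+ m)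
  (fun=> 1) V W (fun=> ler01).
move=> /(_ _ _ w); rewrite p1 mulr1; set b := binconv _ _ _ => h.
apply: (@le_trans _ _ b).
  by apply: h => v; rewrite p1 mulr1; [exact: bV|exact: bW].
rewrite /b binconvE [leRHS]mulrAC [leRHS]mulrC ler_wpM2l //.
have -> : \sum_(j < (size w).+1) M * j`!%:R * l ^+ j / j`!%:R *
    (M * (size w - j)`!%:R * l ^+ (size w - j) / (size w - j)`!%:R) =
  \sum_(j < (size w).+1) M * M * l ^+ size w.
  apply: eq_bigr => j _.
  have -> : l ^+ size w = l ^+ j * l ^+ (size w - j).
    by rewrite -exprD subnKC // -ltnS.
  have := fact_gt0R R j; have := fact_gt0R R (size w - j).
  by move: (j`!%:R) (_`!%:R) => a b' b0 a0; field; rewrite !gt_eqF.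
rewrite sumr_const card_ord -[leLHS]mulr_natr exprMn -[leLHS]mulrA ler_wpM2l ?mulr_ge0 //.
rewrite [leLHS]mulrC ler_wpM2r ?exprn_ge0 //.
by rewrite -natrX ler_nat; exact: ltn_expl.
Qed.

(** The product of the partial sums differs from the partial Cauchy sum by the terms a_j times a
    piece of the tail of b beyond N - j. Each is O((1/4)^N), and N of them are still O((1/2)^N). *)
Lemma cauchy_product_cvg (a b : R^nat) (M A B : R) :
  (forall m, `|a m| <= M * (1 / 4) ^+ m) -> (forall m, `|b m| <= M * (1 / 4) ^+ m) ->
  series a @ \oo --> A -> series b @ \oo --> B ->
  series (fun m => \sum_(j < m.+1) a j * b (m - j)%N) @ \oo --> A * B.
Proof.
move=> ha hb cA cB.
have M0 : 0 <= M by have := ha 0%N; rewrite expr0 mulr1; apply: le_trans.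
have q0 k : 0 <= (1 / 4 : R) ^+ k by apply: exprn_ge0; lra.
(* The factor 1 - (1/4)^p is what lets the induction on p close. *)
have tail m p : `|\sum_(m <= k < m + p) b k| <= 2 * M * (1 / 4) ^+ m * (1 - (1 / 4) ^+ p).
  elim: p => [|p IH]; first by rewrite addn0 big_geq // normr0 subrr mulr0.
  rewrite addnS big_nat_recr ?leq_addr //= (le_trans (ler_normD _ _)) //.
  apply: (le_trans (lerD IH (hb _))); rewrite exprD exprSr.
  have := q0 m; have := q0 p; move: (_ ^+ m) (_ ^+ p) => s t t0 s0.
  have := mulr_ge0 M0 (mulr_ge0 s0 t0); set Q := M * _ => Q0.
  rewrite -/Q.
  have -> : 2 * M * s * (1 - t) = 2 * M * s - 2 * Q by rewrite /Q; ring.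
  have -> : 2 * M * s * (1 - t * (1 / 4)) = 2 * M * s - Q / 2 by rewrite /Q; field.
  by lra.
pose S := series (fun m => \sum_(j < m.+1) a j * b (m - j)%N).
have SE N : S N = \sum_(0 <= j < N) a j * series b (N - j)%N.
  elim: N => [|N IH]; first by rewrite /S /series /= !big_geq.
  have -> : S N.+1 = S N + \sum_(j < N.+1) a j * b (N - j)%N.
    by rewrite /S /series /= big_nat_recr.
  have s1 k : series b k.+1 = series b k + b k.
    by rewrite /series /= big_nat_recr.
  rewrite IH [RHS]big_nat_recr //= subSnn s1 [series b 0]big_geq // add0r.
  rewrite big_ord_recr /= subnn addrA; congr (_ + _).
  rewrite !big_mkord -big_split /=; apply: eq_bigr => j _.
  by rewrite subSn ?s1 ?mulrDr // ltnW.
have d N : `|series a N * series b N - S N| <= 2 * M * M * (1 / 2) ^+ N.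
  rewrite SE {1}/series /= mulr_suml -sumrB big_mkord.
  apply: (@le_trans _ _ (\sum_(j < N) 2 * M * M * (1 / 4) ^+ N)); last first.
    rewrite sumr_const card_ord -[leLHS]mulr_natr -[leLHS]mulrA ler_wpM2l ?mulr_ge0 //.
    have -> : (1 / 4 : R) ^+ N = (1 / 2) ^+ N * (1 / 2) ^+ N.
      by rewrite -exprMn; congr (_ ^+ _); field.
    rewrite -mulrA ler_piMr ?exprn_ge0 ?divr_ge0 //.
    rewrite div1r exprVn ler_pdivrMl ?exprn_gt0 // mulr1 -natrX ler_nat.
    by apply: ltnW; apply: ltn_expl.
  apply: (le_trans (ler_norm_sum _ _ _)); apply: ler_sum => j _.
  rewrite -mulrBr normrM.
  have -> : series b N - series b (N - j)%N = \sum_(N - j <= k < N - j + j) b k.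
    by rewrite subnK ?(ltnW (ltn_ord j)) // sub_series_geq // leq_subr.
  apply: (@le_trans _ _ (M * (1 / 4) ^+ j * (2 * M * (1 / 4) ^+ (N - j)))).
    apply: ler_pM => //; apply: (le_trans (tail _ _)).
    by rewrite ler_piMr ?mulr_ge0 // gerBl.
  rewrite -[X in _ <= _ * _ ^+ X](@subnKC j N) ?(ltnW (ltn_ord j)) // exprD.
  by rewrite le_eqVlt; apply/orP; left; apply/eqP; ring.
have c0 : (fun N => 2 * M * M * (1 / 2 : R) ^+ N) @ \oo --> (0 : R).
  by apply: cvg_geometric; rewrite ger0_norm; lra.
have c1 : (fun N => series a N * series b N - S N) @ \oo --> (0 : R).
  by apply/norm_cvg0P; apply: squeeze_cvgr (cvg_cst 0) c0; apply: nearW => N;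
    rewrite normr_ge0 d.
have E : (fun N => series a N * series b N - (series a N * series b N - S N)) = S.
  by apply/funext => N; rewrite opprB addrC subrK.
by rewrite -/S -E -[A * B]subr0; apply: cvgB c1; exact: cvgM.
Qed.

Lemma taylorM V W f g : taylor V f -> taylor W g ->
  taylor (jmul V W) (fun x => f x * g x).
Proof.
move=> [sV bV cV] [sW bW cW]; have [M [l [M0 l1' hV hW]]] := exp_bounded2 bV bW.
have l0 : 0 <= l by apply: le_trans l1'.
split.
- exact: jmul_symmetric.
- exists (M * M), (2 * l); split; [exact: mulr_ge0|lra|exact: jmul_bounded].
have nx := @near_exp_bounded R n l (1 / 4) l1' (divr_gt0 ltr01 (ltr0Sn R 3)).
near=> x; have xl : l1 x * l <= 1 / 4 by near: x.
have fx : taylor_sum V x @ \oo --> f x by near: x.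
have gx : taylor_sum W x @ \oo --> g x by near: x.
have tb U m : jet_bounded M l U -> `|hom m U x / m`!%:R| <= M * (1 / 4) ^+ m.
  move=> bU; rewrite normrM normfV [`|_%:R|]gtr0_norm ?fact_gt0R //.
  rewrite ler_pdivrMr ?fact_gt0R //.
  apply: le_trans (@le_hom _ _ m U x (M * m`!%:R * l ^+ m) _) _.
    by move=> w <-; exact: bU.
  rewrite -[leLHS]mulrA -exprMn [leRHS]mulrAC ler_wpM2l ?mulr_ge0 //.
  by rewrite mulrC lerXn2r ?nnegrE ?mulr_ge0 ?l1_ge0 //; lra.
have -> : taylor_sum (jmul V W) x = series (fun m => \sum_(j < m.+1)
    (hom j V x / j`!%:R) * (hom (m - j) W x / (m - j)`!%:R)).
  rewrite /taylor_sum; congr series; apply/funext => m.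
  by rewrite hom_mul binconvE mulrAC divff ?mul1r // gt_eqF // fact_gt0R.
exact: cauchy_product_cvg (fun m => tb V m hV) (fun m => tb W m hW) fx gx.
Unshelve. all: by end_near. Qed.

Lemma taylorZ c V f : taylor V f -> taylor (fun w => c * V w) (fun x => c * f x).
Proof.
move=> [sV [M [l [M0 l1' bV]]] cV]; split.
- by move=> w w' p; rewrite (sV _ _ p).
- exists (`|c| * M), l; split=> [||w] //; first exact: mulr_ge0.
  by rewrite normrM -!mulrA ler_wpM2l // mulrA.
apply: filterS cV => x fx.
have -> : taylor_sum (fun w => c * V w) x = (fun N => c * taylor_sum V x N).
  apply/funext => N; rewrite /taylor_sum /series /= mulr_sumr.
  apply: eq_bigr => m _; rewrite mulrA; congr (_ / _).
  have := @hom_sum R n unit [:: tt] (fun=> c) (fun=> V) m x.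
  rewrite big_seq1 => <-; congr (hom m _ x); apply/funext => w.
  by rewrite big_seq1.
exact: cvgMl_tmp.
Qed.

Lemma taylorB V W f g : taylor V f -> taylor W g ->
  taylor (fun w => V w - W w) (fun x => f x - g x).
Proof.
move=> tV tW; have := taylorD tV (taylorZ (-1) tW).
by under [X in taylor X _]eq_fun do rewrite mulN1r;
  under [X in taylor _ X]eq_fun do rewrite mulN1r.
Qed.

Lemma taylor_sumP (I : Type) (s : seq I) (P : pred I) (V : I -> jet R n)
  (f : I -> 'rV[R]_n -> R) : (forall i, P i -> taylor (V i) (f i)) ->
  taylor (fun w => \sum_(i <- s | P i) V i w) (fun x => \sum_(i <- s | P i) f i x).
Proof.
move=> h; elim: s => [|i s IH].
  under [X in taylor X _]eq_fun do rewrite big_nil.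
  under [X in taylor _ X]eq_fun do rewrite big_nil.
  have := taylor_cst 0; congr taylor; apply/funext => w.
  by case: w.
under [X in taylor X _]eq_fun do rewrite big_cons.
under [X in taylor _ X]eq_fun do rewrite big_cons.
by case Pi: (P i) => //; apply: taylorD => //; exact: h.
Qed.

End TaylorClosure.

(** * Analytic germs and jets *)

Section AnalyticTaylor.
Variables (R : realType) (n : nat).
Implicit Types (V W : jet R n) (x : 'rV[R]_n) (f g : 'rV[R]_n -> R).
Implicit Types (a : {ffun 'I_n -> nat}) (w : seq 'I_n).

Definition degree a : nat := (\sum_i a i)%N.

Definition mfact a : nat := (\prod_i (a i)`!)%N.

(** The multi-index of a word; symmetric jets factor through it, since words of equal content are
    permutations of each other. *)
Definition content w : {ffun 'I_n -> nat} := [ffun i => count_mem i w].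

Lemma degree_content w : degree (content w) = size w.
Proof.
elim: w => [|i w IH]; first by rewrite /degree big1 // => i _; rewrite ffunE.
rewrite /= -IH /degree (eq_bigr (fun j => (i == j) + content w j)%N).
  by rewrite big_split /= (bigD1 i) //= eqxx big1 ?addn0 // => j /negbTE;
    rewrite eq_sym => ->.
by move=> j _; rewrite !ffunE.
Qed.

Lemma mfact_gt0 a : (0 < mfact a)%N.
Proof. by apply: prodn_gt0 => i; exact: fact_gt0. Qed.

Lemma mfact_le a : (mfact a <= (degree a)`!)%N.
Proof.
rewrite /mfact /degree; elim/big_rec2: _ => // i y2 y1 _ h.
rewrite (@leq_trans ((a i)`! * y2`!)) ?leq_mul2l ?h ?orbT //.
rewrite -(@bin_fact (a i + y2) (a i)) ?leq_addr // addKn.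
by rewrite leq_pmull // bin_gt0 leq_addr.
Qed.

Definition lower i a : {ffun 'I_n -> nat} := [ffun j => (a j - (i == j))%N].

Definition monomial_jet a : jet R n :=
  fun w => if content w == a then (mfact a)%:R else 0.

Lemma shift_monomial_jet i a :
  jshift i (monomial_jet a) = fun w => (a i)%:R * monomial_jet (lower i a) w.
Proof.
apply/funext => w; rewrite /jshift /monomial_jet.
have cE : content (i :: w) = [ffun j => (content w j + (i == j))%N].
  by apply/ffunP => j; rewrite !ffunE /= addnC.
case: ifPn => [/eqP <-|ne].
  have -> : content w == lower i (content (i :: w)).
    by apply/eqP/ffunP => j; rewrite cE !ffunE addnK.
  rewrite -natrM; congr (_%:R); rewrite /mfact (bigD1 i) //= [in RHS](bigD1 i) //= mulnA.
  congr (_ * _)%N.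
    by rewrite !ffunE /= eqxx add1n subn1 /= factS.
  apply: eq_bigr => j ji; rewrite !ffunE /= [i == j]eq_sym (negbTE ji).
  by rewrite subn0.
case: (posnP (a i)) => [->|ai]; first by rewrite mul0r.
case: ifPn => [/eqP h|_]; last by rewrite mulr0.
case/eqP: ne; apply/ffunP => j; rewrite cE !ffunE.
have /ffunP /(_ j) := h; rewrite !ffunE => ->.
by case: eqP => [<-|_]; rewrite ?subnK // subn0 addn0.
Qed.

(** Euler's identity: direction i contributes [a i] copies of the monomial, and these exponents add
    up to the degree. *)
Lemma hom_monomial_jet m a x : hom m (monomial_jet a) x =
  if m == degree a then m`!%:R * monomial x a else 0.
Proof.
elim: m a => [|m IH] a.
  rewrite /= /monomial_jet; case: eqP => [<-|ne].
    rewrite degree_content /= fact0 mul1r /monomial /mfact big1 ?big1 //.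
      by move=> i _; rewrite ffunE.
    by move=> i _; rewrite ffunE.
  case: eqP => // d0; case: ne; apply/ffunP => i; rewrite !ffunE.
  by move/esym/eqP: d0; rewrite sum_nat_eq0 => /forallP /(_ i) /eqP ->.
have hZ i : hom m (jshift i (monomial_jet a)) x =
    (a i)%:R * hom m (monomial_jet (lower i a)) x.
  rewrite shift_monomial_jet.
  have := @hom_sum R n unit [:: tt] (fun=> (a i)%:R)
    (fun=> monomial_jet (lower i a)) m x.
  rewrite big_seq1 => <-; congr (hom m _ x); apply/funext => w.
  by rewrite big_seq1.
have h i : x 0 i * hom m (jshift i (monomial_jet a)) x =
    if m.+1 == degree a then (a i)%:R * (m`!%:R * monomial x a) else 0.
  rewrite hZ; case: (posnP (a i)) => [->|ai].
    by rewrite !mul0r mulr0; case: ifP.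
  have dE : degree a = (degree (lower i a)).+1.
    rewrite /degree (bigD1 i) //= [in RHS](bigD1 i) //= ffunE eqxx -addSn.
    rewrite subn1 prednK //; congr (_ + _)%N; apply: eq_bigr => j ji.
    by rewrite ffunE eq_sym (negbTE ji) subn0.
  rewrite IH dE eqSS; case: ifP => _; last by rewrite !mulr0.
  rewrite mulrCA; congr (_ * _); rewrite mulrCA; congr (_ * _).
  rewrite /monomial (bigD1 i) //= [in RHS](bigD1 i) //= mulrA ffunE eqxx.
  rewrite -exprS subn1 prednK //; congr (_ * _); apply: eq_bigr => j ji.
  by rewrite ffunE eq_sym (negbTE ji) subn0.
rewrite /=; under eq_bigr do rewrite h.
case: eqP => [dE|_]; last by rewrite big1.
rewrite -mulr_suml mulrA -natr_sum -/(degree a) -dE -natrM.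
by rewrite factS.
Qed.

Lemma eq_hom m V W x : (forall w, size w = m -> V w = W w) ->
  hom m V x = hom m W x.
Proof.
elim: m V W => [|m IH] V W h /=; first exact: h.
by apply: eq_bigr => i _; congr (_ * _); apply: IH => w sw; apply: h => /=; rewrite sw.
Qed.

(** The multinomial bound |a|!/a! <= n^|a|, obtained by evaluating [hom_monomial_jet] at (1, ...,
    1), whose l1 norm is n. *)
Lemma fact_le_mfact a : ((degree a)`! <= mfact a * n ^ degree a)%N.
Proof.
have := hom_monomial_jet (degree a) a (const_mx 1); rewrite eqxx.
rewrite /monomial big1 ?mulr1; last by move=> i _; rewrite mxE expr1n.
have := @le_hom R n (degree a) (monomial_jet a) (const_mx 1) (mfact a)%:R.
have -> : l1 (const_mx 1 : 'rV[R]_n) = n%:R.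
  rewrite /l1 (eq_bigr (fun=> 1)); last by move=> i _; rewrite mxE normr1.
  by rewrite sumr_const card_ord.
move=> h e; move: h; rewrite e normr_nat -natrX -natrM ler_nat; apply.
by move=> w _; rewrite /monomial_jet; case: ifP => _; rewrite ?normr_nat ?normr0.
Qed.

(** * Sums over boxes of multi-indices against sums by degree *)

Section BoxSums.
Variables (c : {ffun 'I_n -> nat} -> R) (M l : R).
Hypotheses (M0 : 0 <= M) (l0 : 0 <= l).
Hypothesis cb : forall a, `|c a| <= M * l ^+ degree a.

Definition coef_jet : jet R n := fun w => (mfact (content w))%:R * c (content w).

Lemma content_perm w w' : perm_eq w w' -> content w = content w'.
Proof. by move=> /permP p; apply/ffunP => i; rewrite !ffunE p. Qed.

Lemma coef_jet_symmetric : symmetric_jet coef_jet.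
Proof. by move=> w w' /content_perm p; rewrite /coef_jet p. Qed.

Lemma coef_jet_bounded : jet_bounded M l coef_jet.
Proof.
move=> w; rewrite /coef_jet normrM normr_nat.
apply: (@le_trans _ _ ((size w)`!%:R * (M * l ^+ size w))); last by rewrite mulrCA mulrA.
by apply: ler_pM => //; rewrite -degree_content ?ler_nat ?mfact_le.
Qed.

Let nf N (a : {ffun 'I_n -> 'I_N}) : {ffun 'I_n -> nat} := [ffun i => a i : nat].

(** One factor (1/2)^|a| is kept for summing over the box, the other gives decay in the degree. *)
Lemma coef_term_bound x a : (forall i, `|x 0 i| * l <= 1 / 4) ->
  `|c a * monomial x a| <= M * ((1 / 2) ^+ degree a * (1 / 2) ^+ degree a).
Proof.
move=> hx; rewrite normrM.
apply: (@le_trans _ _ (M * l ^+ degree a * `|monomial x a|)).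
  by rewrite ler_wpM2r.
rewrite -mulrA ler_wpM2l // -exprMn /monomial normr_prod /degree.
rewrite !expr_sum -big_split /=; apply: ler_prod => i _.
rewrite normrX mulr_ge0 ?exprn_ge0 //= -exprMn.
apply: lerXn2r; rewrite ?nnegrE ?mulr_ge0 ?divr_ge0 //.
by rewrite mulrC; apply: le_trans (hx i) _; lra.
Qed.

(** The sum over the box factors into n geometric sums in one variable, each at most 2. *)
Lemma box_geometric N :
  \sum_(a : {ffun 'I_n -> 'I_N}) (1 / 2 : R) ^+ degree (nf a) <= 2 ^+ n.
Proof.
have -> : \sum_(a : {ffun 'I_n -> 'I_N}) (1 / 2 : R) ^+ degree (nf a) =
    \prod_(i < n) \sum_(j < N) (1 / 2 : R) ^+ j.
  rewrite bigA_distr_bigA /=; apply: eq_bigr => a _.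
  by rewrite /degree expr_sum; apply: eq_bigr => i _; rewrite ffunE.
apply: (@le_trans _ _ (\prod_(i < n) 2)); last by rewrite prodr_const card_ord.
apply: ler_prod => i _; rewrite sumr_ge0 /=; last by move=> j _; rewrite exprn_ge0 // divr_ge0.
have [|_ /(_ N)] := @geometric_dominated R (fun m => (1 / 2) ^+ m) 1.
  by move=> m; rewrite [leRHS]mul1r ger0_norm // exprn_ge0 // divr_ge0.
by rewrite mulr1 /series /= big_mkord; apply: le_trans; exact: ler_norm.
Qed.

Lemma box_abs_bound x N : (forall i, `|x 0 i| * l <= 1 / 4) ->
  \sum_(a : {ffun 'I_n -> 'I_N}) `|c (nf a) * monomial x (nf a)| <= M * 2 ^+ n.
Proof.
move=> hx; apply: (@le_trans _ _ (\sum_(a : {ffun 'I_n -> 'I_N}) M * (1 / 2) ^+ degree (nf a))).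
  apply: ler_sum => a _; apply: (le_trans (coef_term_bound _ hx)).
  rewrite ler_wpM2l // ler_piMr ?exprn_ge0 ?divr_ge0 //.
  by rewrite exprn_ile1 ?divr_ge0 //; lra.
by rewrite -mulr_sumr ler_wpM2l // box_geometric.
Qed.

(** A multi-index of degree below N has all its entries below N, so the terms of the Taylor sum all
    lie in the box. *)
Lemma taylor_sum_box x N : taylor_sum coef_jet x N =
  \sum_(a : {ffun 'I_n -> 'I_N} | (degree (nf a) < N)%N)
     c (nf a) * monomial x (nf a).
Proof.
have h m : (m < N)%N -> hom m coef_jet x = \sum_(a : {ffun 'I_n -> 'I_N})
    c (nf a) * (if m == degree (nf a) then m`!%:R * monomial x (nf a) else 0).
  move=> mN; under eq_bigr do rewrite -hom_monomial_jet.
  rewrite -hom_sum; apply: eq_hom => w sw.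
  have cN i : (content w i < N)%N.
    by rewrite ffunE; apply: leq_ltn_trans (count_size _ _) _; rewrite sw.
  pose b : {ffun 'I_n -> 'I_N} := [ffun i => Ordinal (cN i)].
  have nb : nf b = content w by apply/ffunP => i; rewrite !ffunE /= ffunE.
  rewrite (bigD1 b) //= nb /monomial_jet eqxx big1 ?addr0 1?mulrC //.
  move=> a ab; case: eqP => [h|]; last by rewrite mulr0.
  case/eqP: ab; apply/ffunP => i; apply/val_inj.
  by move/ffunP: h => /(_ i); rewrite !ffunE /= !ffunE.
rewrite /taylor_sum /series /= big_mkord.
rewrite (eq_bigr (fun m : 'I_N => \sum_(a : {ffun 'I_n -> 'I_N}) c (nf a) *
    (if m == degree (nf a) :> nat then m`!%:R * monomial x (nf a) else 0) / m`!%:R));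
  last by move=> m _; rewrite h // mulr_suml.
rewrite exchange_big /= [RHS]big_mkcond; apply: eq_bigr => a _.
case: ifP => [dN|dN].
  rewrite (bigD1 (Ordinal dN)) //= eqxx big1 ?addr0.
    by rewrite -mulrA [_ * monomial _ _]mulrC mulfK // gt_eqF // fact_gt0R.
  by move=> m; rewrite -val_eqE /= => /negbTE ->; rewrite mulr0 mul0r.
apply: big1 => m _; case: eqP => [e|]; last by rewrite mulr0 mul0r.
by move: (ltn_ord m); rewrite e dN.
Qed.

(** What the box has in excess consists of terms of degree at least N, each carrying a factor
    (1/2)^N. *)
Lemma box_close x N : (forall i, `|x 0 i| * l <= 1 / 4) ->
  `|power_series_box c x N - taylor_sum coef_jet x N| <= M * 2 ^+ n * (1 / 2) ^+ N.
Proof.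
move=> hx; rewrite taylor_sum_box /power_series_box /=.
rewrite (bigID (fun a : {ffun 'I_n -> 'I_N} => degree (nf a) < N)%N) /= [X in `|X|]addrC addKr.
apply: (le_trans (ler_norm_sum _ _ _)).
apply: (@le_trans _ _ (\sum_(a : {ffun 'I_n -> 'I_N})
   M * (1 / 2) ^+ N * (1 / 2) ^+ degree (nf a))); last first.
  rewrite -mulr_sumr [leRHS]mulrAC ler_wpM2l ?box_geometric //.
  by rewrite mulr_ge0 // exprn_ge0 // divr_ge0.
rewrite big_mkcond /=; apply: ler_sum => a _; case: ifPn => [|_]; last first.
  by rewrite !mulr_ge0 // exprn_ge0 // divr_ge0.
rewrite -leqNgt => dN; apply: (le_trans (coef_term_bound _ hx)).
rewrite -mulrA ler_wpM2l // ler_wpM2r ?exprn_ge0 ?divr_ge0 //.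
by rewrite ler_wiXn2l ?divr_ge0 //; lra.
Qed.

Lemma box_cvg x (L : R) : (forall i, `|x 0 i| * l <= 1 / 4) ->
  (power_series_box c x @ \oo --> L) <-> (taylor_sum coef_jet x @ \oo --> L).
Proof.
move=> hx.
have c0 : (fun N => M * 2 ^+ n * (1 / 2 : R) ^+ N) @ \oo --> (0 : R).
  by apply: cvg_geometric; rewrite ger0_norm; lra.
have c1 : (fun N => power_series_box c x N - taylor_sum coef_jet x N) @ \oo --> (0 : R).
  by apply/norm_cvg0P; apply: squeeze_cvgr (cvg_cst 0) c0; apply: nearW => N;
    rewrite normr_ge0 box_close.
split=> h.
- have -> : taylor_sum coef_jet x = (fun N => power_series_box c x N -
    (power_series_box c x N - taylor_sum coef_jet x N)).
    by apply/funext => N; rewrite opprB addrC subrK.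
  by rewrite -[L]subr0; exact: cvgB.
- have -> : power_series_box c x = (fun N => taylor_sum coef_jet x N +
    (power_series_box c x N - taylor_sum coef_jet x N)).
    by apply/funext => N; rewrite addrC subrK.
  by rewrite -[L]addr0; exact: cvgD.
Qed.

(** Every finite set of multi-indices lies in some box, where [box_abs_bound] is uniform. *)
Lemma box_summable x : (forall i, `|x 0 i| * l <= 1 / 4) ->
  summable [set: {ffun 'I_n -> nat}] (fun a => (c a * monomial x a)%:E).
Proof.
move=> hx; rewrite /summable; apply: (@le_lt_trans _ _ (M * 2 ^+ n)%:E); last exact: ltry.
apply: ub_ereal_sup => _ [A [finA _] <-].
rewrite fsbig_finite //= (eq_bigr (fun a => (`|c a * monomial x a|)%:E)) // sumEFin lee_fin.
set s : seq {ffun 'I_n -> nat} := finmap.enum_fset (fset_set A).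
pose N := (\max_(a <- s) \max_i a i).+1.
have sN a i : a \in s -> (a i < N)%N.
  move=> As; rewrite ltnS; apply: leq_trans (leq_bigmax_seq _ As isT).
  exact: (leq_bigmax i).
apply: le_trans (box_abs_bound N hx).
pose B := [pred b : {ffun 'I_n -> 'I_N} | nf b \in s].
have -> : \sum_(a <- s) `|c a * monomial x a| = \sum_(b in B) `|c (nf b) * monomial x (nf b)|.
  rewrite -big_enum -(big_map (@nf N) xpredT (fun a => `|c a * monomial x a|)).
  apply: perm_big; apply: uniq_perm; first exact: finmap.fset_uniq.
    rewrite map_inj_uniq ?enum_uniq // => b b' /ffunP h; apply/ffunP => i.
    by apply/val_inj; have := h i; rewrite !ffunE.
  move=> a; apply/idP/mapP => [As|[b]]; last by rewrite mem_enum inE => ? ->.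
  have [b aE] : exists b : {ffun 'I_n -> 'I_N}, a = nf b.
    exists [ffun i => Ordinal (sN a i As)].
    by apply/ffunP => i; rewrite !ffunE.
  by exists b => //; rewrite mem_enum inE /= -aE.
rewrite [leRHS](bigID (mem B)) /= lerDl; exact: sumr_ge0.
Qed.

End BoxSums.

(** Absolute convergence at the single point (r, ..., r) with r > 0 gives |c_a| <= S r^-|a|, hence
    the growth bound; [box_cvg] then passes from box sums to Taylor sums. *)
Lemma analytic_taylor f : analytic f -> exists V, taylor V f.
Proof.
case=> c hc; have [d /= d0 hd] := nbhs_norm0P.1 hc.
pose r := d / 2; have r0 : 0 < r by rewrite divr_gt0.
have nr : `|const_mx r : 'rV[R]_n| < d.
  rewrite [ltLHS]/Num.Def.normr /= mx_normrE.
  apply: (@le_lt_trans _ _ r); last by rewrite /r; lra.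
  by apply: bigmax_le => [|i _]; [exact: ltW|rewrite mxE gtr0_norm].
have [sm _] := hd _ nr.
have mon a : monomial (const_mx r) a = r ^+ degree a.
  by rewrite /monomial /degree expr_sum; apply: eq_bigr => i _; rewrite mxE.
set S := (\esum_(a in setT) `|(c a * monomial (const_mx r) a)%:E|)%E in sm.
have S0 : (0 <= S)%E by apply: esum_ge0.
have SF : S \is a fin_num by rewrite ge0_fin_numE.
have cb a : `|c a| <= fine S * r^-1 ^+ degree a.
  have : (`|(c a * monomial (const_mx r) a)%:E| <= S)%E.
    apply: esum_ge; exists [set a]; first by split.
    by rewrite fsbig_set1.
  rewrite -[in X in (_ <= X)%E -> _](fineK SF) /= lee_fin mon normrM.
  rewrite [`|r ^+ _|]ger0_norm ?exprn_ge0 ?(ltW r0) //.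
  by rewrite exprVn ler_pdivlMr ?exprn_gt0.
have M0 : 0 <= fine S by exact: fine_ge0.
have l0 : 0 <= r^-1 by rewrite invr_ge0 ltW.
exists (coef_jet c); split.
- exact: coef_jet_symmetric.
- exists (fine S), (1 + r^-1); split; rewrite ?lerDl //.
  apply: (@jet_bounded_le _ _ (fine S) r^-1); rewrite ?lerDr //.
  exact: coef_jet_bounded.
have nx := @near_l1 R n _ (divr_gt0 r0 (ltr0Sn R 3)).
apply: filterS2 hc nx => x [_ cx] xr.
apply: (box_cvg M0 l0 cb _ _).1 cx => i.
rewrite ler_pdivrMr //; apply: (@le_trans _ _ (l1 x)); last by lra.
by rewrite /l1 (bigD1 i) //= lerDl sumr_ge0.
Qed.

Lemma taylor_analytic V f : taylor V f -> analytic f.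
Proof.
move=> [sV [M [l [M0 l1' bV]]] cV].
have l0 : 0 <= l by apply: le_trans l1'.
pose wd a : seq 'I_n := flatten [seq nseq (a i) i | i <- enum 'I_n].
have wdE a : content (wd a) = a.
  apply/ffunP => i; rewrite ffunE count_flatten -map_comp sumnE big_map big_enum /=.
  rewrite (bigD1 i) //= count_nseq /= eqxx mul1n big1 ?addn0 // => j ji.
  by rewrite count_nseq /= (negbTE ji).
pose c a := V (wd a) / (mfact a)%:R.
have f0 a : 0 < (mfact a)%:R :> R by rewrite ltr0n mfact_gt0.
have VE : V = coef_jet c.
  apply/funext => w; rewrite /coef_jet /c mulrC divfK ?gt_eqF //.
  apply: sV; apply/permP => p; rewrite -!sumn_count.
  have pw : perm_eq w (wd (content w)).
    by apply/allP => i _ /=; have /ffunP /(_ i) := wdE (content w); rewrite !ffunE => ->.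
  by apply/perm_sumn; apply: perm_map.
(* Applying [fact_le_mfact] costs n^|a|; n+1 in place of n keeps the rate at least 1 also when n =
   0. *)
have cb a : `|c a| <= M * (n.+1%:R * l) ^+ degree a.
  rewrite /c normrM normfV normr_nat ler_pdivrMr //.
  apply: (le_trans (bV _)).
  have -> : size (wd a) = degree a by rewrite -degree_content wdE.
  have -> : M * (n.+1%:R * l) ^+ degree a * (mfact a)%:R =
      M * ((mfact a)%:R * n.+1%:R ^+ degree a) * l ^+ degree a.
    by rewrite exprMn; ring.
  rewrite ler_wpM2r ?exprn_ge0 // ler_wpM2l // -natrX -natrM ler_nat.
  apply: leq_trans (fact_le_mfact a) _; rewrite leq_mul2l; apply/orP; right.
  by case: (degree a) => // k; rewrite leq_exp2r.
have L1 : 1 <= n.+1%:R * l.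
  by rewrite (le_trans l1') // ler_peMl // ler1n.
have L0 : 0 <= n.+1%:R * l by apply: le_trans L1.
exists c; have nx := @near_exp_bounded R n _ (1 / 4) L1 (divr_gt0 ltr01 (ltr0Sn R 3)).
apply: filterS2 cV nx => x fx xl.
have hx i : `|x 0 i| * (n.+1%:R * l) <= 1 / 4.
  apply: le_trans xl; rewrite ler_wpM2r //.
  by rewrite /l1 (bigD1 i) //= lerDl sumr_ge0.
split; first exact: (box_summable M0 L0 cb).
by apply/(box_cvg M0 L0 cb _ hx); rewrite -VE.
Qed.

End AnalyticTaylor.

(** * The formal Cauchy problem *)

Section WeightedJets.
Variables (R : realType) (n : nat) (t : 'I_n) (lam K : R).
Hypotheses (lam1 : 1 <= lam) (K1 : 1 <= K).
Implicit Types (V W : jet R n) (w : seq 'I_n).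

(* The majorant: derivatives at 0 of g(lam (x_1 + ... + K x_t + ... + x_n))    *)
(* where g(s) is the sum of the s^m / (m + 1)^2.                               *)
Definition letter_weight (i : 'I_n) : R := if i == t then K * lam else lam.

Definition weight w : R :=
  (size w)`!%:R / (size w).+1%:R ^+ 2 * \prod_(i <- w) letter_weight i.

Let lam0 : 0 < lam. Proof. exact: lt_le_trans lam1. Qed.
Let K0 : 0 < K. Proof. exact: lt_le_trans K1. Qed.

Lemma letter_weight_ge i : lam <= letter_weight i.
Proof. by rewrite /letter_weight; case: ifP => // _; rewrite ler_peMl // ltW. Qed.

Lemma letter_weight_gt0 i : 0 < letter_weight i.
Proof. exact: lt_le_trans (letter_weight_ge i). Qed.

Lemma weight_gt0 w : 0 < weight w.
Proof.
rewrite mulr_gt0 ?divr_gt0 ?fact_gt0R ?exprn_gt0 //.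
by elim: w => [|i w IH]; rewrite ?big_nil // big_cons mulr_gt0 ?letter_weight_gt0.
Qed.

Lemma weight_perm w w' : perm_eq w w' -> weight w = weight w'.
Proof. by move=> p; rewrite /weight (perm_size p) (perm_big _ p). Qed.

(** Telescoping: 1/(a+1)^2 <= 1/a - 1/(a+1). *)
Lemma sum_inv_squares m : \sum_(j < m.+1) (j.+1%:R : R) ^- 2 <= 2 - m.+1%:R^-1.
Proof.
elim: m => [|m IH]; first by rewrite big_ord1 /= expr1n invr1; lra.
rewrite big_ord_recr /=; apply: le_trans (lerD IH (lexx _)) _.
have a0 : 0 < m.+1%:R :> R by [].
rewrite -[m.+2%:R]natr1; move: (m.+1%:R) a0 => a a0.
rewrite -subr_ge0.
have -> : 2 - (a + 1)^-1 - (2 - a^-1 + (a + 1) ^- 2) = (a * (a + 1) ^+ 2)^-1.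
  by field; rewrite !gt_eqF //; lra.
by rewrite invr_ge0 mulr_ge0 ?exprn_ge0 //; lra.
Qed.

(** With a + b = m + 2, 1/(ab)^2 <= 2 (1/a^2 + 1/b^2)/(a+b)^2, the difference being a square. This
    is the reason for the factor (m+1)^-2 in the weight: without it, convolution would cost a factor
    m+1. *)
Lemma inv_squares_conv m :
  \sum_(j < m.+1) (j.+1%:R : R) ^- 2 * ((m - j).+1%:R) ^- 2 <= 8 * m.+1%:R ^- 2.
Proof.
apply: (@le_trans _ _ (\sum_(j < m.+1) 2 * m.+2%:R ^- 2 *
    ((j.+1%:R : R) ^- 2 + ((m - j).+1%:R) ^- 2))).
  apply: ler_sum => j _.
  have -> : m.+2%:R = j.+1%:R + (m - j).+1%:R :> R.
    by rewrite -natrD addSn addnS subnKC // -ltnS.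
  have : 0 < j.+1%:R :> R by []; have : 0 < (m - j).+1%:R :> R by [].
  move: (j.+1%:R) (_.+1%:R) => a b b0 a0.
  rewrite -subr_ge0.
  have -> : 2 * (a + b) ^- 2 * (a ^- 2 + b ^- 2) - a ^- 2 * b ^- 2 =
     ((a - b) / (a * b * (a + b))) ^+ 2.
    by field; rewrite !gt_eqF //; lra.
  exact: sqr_ge0.
rewrite -mulr_sumr big_split /=.
have -> : \sum_(j < m.+1) ((m - j).+1%:R : R) ^- 2 = \sum_(j < m.+1) (j.+1%:R : R) ^- 2.
  rewrite (reindex_inj rev_ord_inj) /=; apply: eq_bigr => j _.
  by rewrite subSS subKn // -ltnS.
have s2 : \sum_(j < m.+1) (j.+1%:R : R) ^- 2 <= 2.
  by apply: le_trans (sum_inv_squares m) _; rewrite gerBl invr_ge0.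
apply: (@le_trans _ _ (2 * m.+2%:R ^- 2 * 4)).
  by rewrite ler_wpM2l ?mulr_ge0 ?invr_ge0 ?exprn_ge0 //; lra.
rewrite mulrAC -natrM ler_wpM2l // lef_pV2 ?posrE ?exprn_gt0 //.
by rewrite lerXn2r ?nnegrE // ler_nat.
Qed.

Lemma weight_jmul A B V W : 0 <= A -> 0 <= B ->
  (forall w, `|V w| <= A * weight w) -> (forall w, `|W w| <= B * weight w) ->
  forall w, `|jmul V W w| <= 8 * A * B * weight w.
Proof.
move=> A0 B0 hV hW w.
have := @le_jmul R n (fun m => A * (m`!%:R / m.+1%:R ^+ 2))
  (fun m => B * (m`!%:R / m.+1%:R ^+ 2)) letter_weight V W.
move=> /(_ (fun i => ltW (letter_weight_gt0 i)) _ _ w) h.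
apply: le_trans (h _ _) _; [by move=> v; rewrite -mulrA; exact: hV
  |by move=> v; rewrite -mulrA; exact: hW|].
rewrite /weight mulrA ler_wpM2r //.
  by apply: prodr_ge0 => i _; exact/ltW/letter_weight_gt0.
rewrite binconvZl binconvZr binconvE.
have -> : 8 * A * B * ((size w)`!%:R / (size w).+1%:R ^+ 2) =
  A * (B * ((size w)`!%:R * (8 * (size w).+1%:R ^- 2))) by ring.
rewrite !ler_wpM2l //; apply: le_trans (inv_squares_conv _).
rewrite le_eqVlt; apply/orP; left; apply/eqP; apply: eq_bigr => j _.
by congr (_ * _); rewrite mulrAC divff ?mul1r // gt_eqF // fact_gt0R.
Qed.

(** The gain for tangential derivatives, compared with d_t. *)
Lemma weight_cons_tangential k w : k != t -> weight (k :: w) = K^-1 * weight (t :: w).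
Proof.
move=> /negbTE kt; rewrite /weight !big_cons {1 3}/letter_weight kt eqxx /=.
by move: (\prod_(i <- w) _) (_ / _) => P f; field; rewrite gt_eqF.
Qed.

(** The gain for terms without derivatives. The constant 4 comes from (a+1)^2 <= 4 a^3 for a = |w| +
    1 >= 1. *)
Lemma weight_le_cons w : weight w <= 4 / K * weight (t :: w).
Proof.
rewrite /weight big_cons {2}/letter_weight eqxx /= factS natrM.
set F := _`!%:R; set P := \prod_(i <- w) _; set a : R := (size w).+1%:R.
have F0 : 0 < F by exact: fact_gt0R.
have P0 : 0 <= P.
  by apply: prodr_ge0 => i _; exact/ltW/letter_weight_gt0.
have a1 : 1 <= a by rewrite ler1n.
have -> : (size w).+2%:R = a + 1 :> R by rewrite natr1.
clearbody F P a.
have -> : 4 / K * (a * F / (a + 1) ^+ 2 * (K * lam * P)) =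
   (F / a ^+ 2 * P) * (lam * (4 * a ^+ 3 / (a + 1) ^+ 2)).
  by field; rewrite !gt_eqF //; lra.
have a0 : 0 <= a by lra.
rewrite ler_peMr ?mulr_ge0 ?invr_ge0 ?exprn_ge0 ?(ltW F0) //.
rewrite -[leLHS]mulr1; apply: ler_pM => //.
have s0 : 0 < (a + 1) ^+ 2 by apply: exprn_gt0; lra.
rewrite ler_pdivlMr // mul1r.
by rewrite !exprS expr0; nra.
Qed.

(** The ratio lam/mu >= 4 pays for the denominator, as (m+1)^2 <= 4^m. The bound is free of K, which
    [weight_data_cons] exploits. *)
Lemma weight_data M mu V w : 0 <= M -> 0 <= mu -> 4 * mu <= lam ->
  jet_bounded M mu V -> `|V w| <= M * ((size w)`!%:R / (size w).+1%:R ^+ 2 * lam ^+ size w).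
Proof.
move=> M0 mu0 ml bV; apply: (le_trans (bV w)); rewrite -mulrA ler_wpM2l //.
rewrite -mulrA ler_wpM2l // mulrC ler_pdivlMr ?exprn_gt0 //.
apply: (@le_trans _ _ ((4 * mu) ^+ size w)); last first.
  by rewrite lerXn2r ?nnegrE ?mulr_ge0 // ltW.
rewrite exprMn mulrC ler_wpM2r ?exprn_ge0 //.
rewrite -!natrX ler_nat -[4%N]/(2 ^ 2)%N -expnM mulnC expnM leq_exp2r //.
exact: ltn_expl.
Qed.

Lemma prod_letter_weight_ge w : lam ^+ size w <= \prod_(i <- w) letter_weight i.
Proof.
elim: w => [|i w IH]; first by rewrite big_nil.
rewrite big_cons exprS; apply: ler_pM; rewrite ?exprn_ge0 ?letter_weight_ge //; exact: ltW.
Qed.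

Lemma weight_data_le M mu V w : 0 <= M -> 0 <= mu -> 4 * mu <= lam ->
  jet_bounded M mu V -> `|V w| <= M * weight w.
Proof.
move=> M0 mu0 ml bV; apply: (le_trans (weight_data w M0 mu0 ml bV)).
rewrite ler_wpM2l // ler_wpM2l ?divr_ge0 ?exprn_ge0 //.
exact: prod_letter_weight_ge.
Qed.

(** The gain for d_t of prescribed data: their bound does not involve K, whereas each letter t puts
    a factor K into the weight. *)
Lemma weight_data_cons M mu V w : 0 <= M -> 0 <= mu -> 4 * mu <= lam ->
  jet_bounded M mu V -> `|V (t :: w)| <= M / K * weight (t :: w).
Proof.
move=> M0 mu0 ml bV; apply: (le_trans (weight_data (t :: w) M0 mu0 ml bV)).
rewrite -[leRHS]mulrA ler_wpM2l // /weight [leRHS]mulrCA ler_wpM2l ?divr_ge0 ?exprn_ge0 //.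
rewrite big_cons {1}/letter_weight eqxx -mulrA mulKf ?gt_eqF //= exprS.
by rewrite ler_wpM2l ?(ltW lam0) // prod_letter_weight_ge.
Qed.

Lemma weight_exp_bounded C V : 0 <= C -> (forall w, `|V w| <= C * weight w) ->
  exp_bounded V.
Proof.
move=> C0 h; exists C, (K * lam); split=> // [|w].
  by rewrite (le_trans lam1) // ler_peMl // ltW.
apply: (le_trans (h w)); rewrite -mulrA ler_wpM2l // /weight.
apply: ler_pM; rewrite ?divr_ge0 ?exprn_ge0 //.
- by apply: prodr_ge0 => i _; exact/ltW/letter_weight_gt0.
- by rewrite ler_pdivrMr ?exprn_gt0 // ler_peMr // exprn_ege1 // ler1n.
elim: w => [|i w IH]; first by rewrite big_nil.
rewrite big_cons exprS; apply: ler_pM => //.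
- exact/ltW/letter_weight_gt0.
- by apply: prodr_ge0 => j _; exact/ltW/letter_weight_gt0.
by rewrite /letter_weight; case: ifP => // _; rewrite ler_peMl // ltW.
Qed.

End WeightedJets.

(** * Solving d_t U = F U on jets with given tangential derivatives *)

Section FormalCauchyProblem.
Variables (R : realType) (n : nat) (t : 'I_n) (I : Type).
Implicit Types (U : I -> jet R n) (w : seq 'I_n).

Definition agree_upto (c : nat) (V W : jet R n) :=
  forall w, (count_mem t w <= c)%N -> V w = W w.

(** Encodes that F contains no d_t of the unknowns: entries of F U with at most c letters t only see
    such entries of U. *)
Definition local (F : (I -> jet R n) -> I -> jet R n) := forall c U U',
  (forall i, agree_upto c (U i) (U' i)) -> forall i, agree_upto c (F U i) (F U' i).

Lemma agree_jmul c V V' W W' : agree_upto c V V' -> agree_upto c W W' ->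
  agree_upto c (jmul V W) (jmul V' W').
Proof.
move=> hV hW w; elim: w c V V' W W' hV hW => [|i w IH] c V V' W W' hV hW /=.
  by move=> _; rewrite hV // hW.
move=> hc; have cw : (count_mem t w <= c - (i == t))%N.
  by move: hc; case: (i == t) => /=; lia.
have sh X X' : agree_upto c X X' -> agree_upto (c - (i == t)) (jshift i X) (jshift i X').
  by move=> hX v cv; apply: hX; move: hc cv => /=; case: (i == t) => /=; lia.
have wk X X' : agree_upto c X X' -> agree_upto (c - (i == t)) X X'.
  by move=> hX v cv; apply: hX; move: cv; case: (i == t) => /=; lia.
by congr (_ + _); apply: IH cw; auto.
Qed.

Lemma count_mem_rem w : t \in w -> count_mem t w = (count_mem t (rem t w)).+1.
Proof. by move=> tw; rewrite (permP (perm_to_rem tw)) /= eqxx. Qed.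

Variables (F : (I -> jet R n) -> I -> jet R n).
Hypothesis F_local : local F.

(** Induction on the number of letters t: symmetry brings one t to the front, where the equation and
    locality reduce to words with one t less. *)
Lemma cauchy_problem_unique U U' :
  (forall i, symmetric_jet (U i)) -> (forall i, symmetric_jet (U' i)) ->
  (forall i w, U i (t :: w) = F U i w) -> (forall i w, U' i (t :: w) = F U' i w) ->
  (forall i w, t \notin w -> U i w = U' i w) -> forall i, U i = U' i.
Proof.
move=> sU sU' eU eU' h0.
have h c : forall i, agree_upto c (U i) (U' i).
  elim: c => [|c IH] i w cw.
    by apply: h0; rewrite -has_pred1 has_count -leqNgt.
  case: (boolP (t \in w)) => [tw|]; last exact: h0.
  have p := perm_to_rem tw; rewrite (sU _ _ _ p) (sU' _ _ _ p) eU eU'.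
  by apply: F_local IH i _ _; rewrite -ltnS -count_mem_rem.
by move=> i; apply/funext => w; apply: (h (count_mem t w)).
Qed.

Variables (psi : I -> jet R n) (om : seq 'I_n -> R) (C : R).
Hypothesis F_symmetric : forall U, (forall i, symmetric_jet (U i)) ->
  forall i, symmetric_jet (F U i).
Hypothesis om_perm : forall w w', perm_eq w w' -> om w = om w'.
Hypothesis om_ge0 : forall w, 0 <= C * om w.
Hypothesis F_bound : forall U, (forall i, symmetric_jet (U i)) ->
  (forall i w, `|U i w| <= C * om w) ->
  forall i w, `|F U i w| <= C * om (t :: w).
Hypothesis psi_symmetric : forall i, symmetric_jet (psi i).
Hypothesis psi_bound : forall i w, `|psi i w| <= C * om w.

(** Picard iteration on the number of letters t. After s steps the entries at words with fewer than
    s letters t are final ([approx_stable]), and [F_bound] reproduces the same bound at every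
    step. *)
Let step U : I -> jet R n :=
  fun i w => if t \in w then F U i (rem t w) else psi i w.

Let approx s := iter s step (fun _ _ => 0).

Let approx_symmetric s i : symmetric_jet (approx s i).
Proof.
elim: s i => [//|s IH] i w w' p /=; rewrite /step -(perm_mem p).
case: ifPn => tw; last exact: psi_symmetric.
apply: F_symmetric => //; rewrite -(perm_cons t).
rewrite -(permPl (perm_to_rem tw)); apply: (perm_trans p).
by apply: perm_to_rem; rewrite -(perm_mem p).
Qed.

Let approx_bound s i w : `|approx s i w| <= C * om w.
Proof.
elim: s i w => [|s IH] i w /=; first by rewrite normr0.
rewrite /step; case: ifPn => tw; last exact: psi_bound.
by rewrite (om_perm (perm_to_rem tw)); apply: F_bound.
Qed.

Let approx_agree s i w : (count_mem t w < s)%N -> approx s.+1 i w = approx s i w.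
Proof.
elim: s i w => [//|s IH] i w ws.
rewrite /approx /= /step -!/(step _) -!/(approx _); case: ifPn => // tw.
move: ws; rewrite (count_mem_rem tw) ltnS => ws.
case: s IH ws => // s IH ws.
by apply: (F_local (c := s)) => // j v vs; apply: IH.
Qed.

Let approx_stable s i w : (count_mem t w < s)%N ->
  approx s i w = approx (count_mem t w).+1 i w.
Proof.
elim: s => [//|s IH]; rewrite ltnS leq_eqVlt => /orP[/eqP -> //|ws].
by rewrite approx_agree ?IH.
Qed.

Lemma cauchy_problem_exists : exists U,
  [/\ forall i, symmetric_jet (U i), forall i w, `|U i w| <= C * om w,
      forall i w, t \notin w -> U i w = psi i w &
      forall i w, U i (t :: w) = F U i w].
Proof.
(* Each entry is read at the first step where it is final. *)
pose U i w := approx (count_mem t w).+1 i w; exists U; split.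
- move=> i w w' p; rewrite /U (permP p); exact: approx_symmetric.
- by move=> i w; exact: approx_bound.
- by move=> i w tw; rewrite /U /= /step (negbTE tw).
- move=> i w; rewrite /U /= eqxx add1n.
  rewrite -/(approx (count_mem t w).+1) {1}/step mem_head /= eqxx.
  apply: (F_local (c := count_mem t w)) => // j v vw.
  exact: (@approx_stable (count_mem t w).+1).
Qed.

End FormalCauchyProblem.

(** * The Ricci equation on jets *)

Section Slots.
Variables (R : realType) (n : nat) (t o : 'I_n).
Hypothesis ot : o != t.

Let triple := ('I_n * 'I_n * 'I_n)%type.
Implicit Types (s : triple) (i j k : 'I_n).

(* The equation Ric(d_i, d_j) = r_ij is solved for d_t of the Christoffel      *)
(* symbol slot (i, j), and tau(d_j) = 0 for tau_slot j.                        *)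
Definition slot (p : 'I_n * 'I_n) : triple :=
  if p.1 != t then (p.1, p.2, t) else (o, p.2, o).

Definition tau_slot (j : 'I_n) : triple := if j != t then (t, j, t) else (t, o, o).

Definition is_slot s := (s.1.1 != t) && (s.2 == t) || (s.1.1 == o) && (s.2 == o).

Definition is_tau_slot s :=
  (s.1.1 == t) && ((s.2 == t) && (s.1.2 != t) || (s.1.2 == o) && (s.2 == o)).

Definition unslot s : 'I_n * 'I_n := if s.2 == t then s.1 else (t, s.1.2).

Definition is_free s := ~~ is_slot s && ~~ is_tau_slot s.

Lemma slotK : cancel slot unslot.
Proof.
move=> [i j]; rewrite /slot /unslot /=.
by case: (eqVneq i t) => [->|] /=; rewrite ?eqxx // (negbTE ot).
Qed.

Lemma is_slot_slot p : is_slot (slot p).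
Proof.
case: p => i j; rewrite /slot /is_slot /=; case: (eqVneq i t) => [->|it] /=.
  by rewrite !eqxx orbT.
by rewrite it eqxx.
Qed.

Lemma unslotK s : is_slot s -> slot (unslot s) = s.
Proof.
case: s => [[i j] k]; rewrite /is_slot /slot /unslot /=.
case: (eqVneq k t) => [->|kt] /=; last by rewrite andbF eqxx => /andP[/eqP -> /eqP ->].
by rewrite andbT [t == o]eq_sym (negbTE ot) andbF orbF => ->.
Qed.

Lemma slot_inj : injective slot. Proof. exact: can_inj slotK. Qed.

Lemma tau_slot_inj : injective tau_slot.
Proof.
move=> j k; rewrite /tau_slot.
case: (eqVneq j t) => [->|jt]; case: (eqVneq k t) => [->|kt] //=.
- by move=> [_ /eqP]; rewrite (negbTE ot).
- by move=> [_ /esym/eqP]; rewrite (negbTE ot).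
- by case.
Qed.

Lemma is_tau_slotP s : reflect (exists j, s = tau_slot j) (is_tau_slot s).
Proof.
case: s => [[i j] k]; rewrite /is_tau_slot /tau_slot /=.
apply: (iffP idP) => [/andP[/eqP -> /orP[/andP[/eqP -> jt]|/andP[/eqP -> /eqP ->]]]|].
- by exists j; rewrite jt.
- by exists t; rewrite eqxx.
case=> l; case: (eqVneq l t) => [_|lt] [-> -> ->]; rewrite !eqxx ?orbT //=.
by rewrite lt.
Qed.

Lemma slot_not_tau s : is_slot s -> ~~ is_tau_slot s.
Proof.
case: s => [[i j] k]; rewrite /is_slot /is_tau_slot /=.
by case: (eqVneq i t) => [->|] //=; rewrite [t == o]eq_sym (negbTE ot).
Qed.

(** Slots and tau slots are disjoint injective images of n^2 and n indices. *)
Lemma card_free :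
  (#|[pred s | is_free s]| = n ^ 3 - n ^ 2 - n)%N.
Proof.
have cT : #|{: triple}| = (n ^ 3)%N.
  by rewrite !card_prod !card_ord !expnS expn0 muln1 mulnA.
have cS : #|[pred s | is_slot s]| = (n ^ 2)%N.
  have -> : #|[pred s | is_slot s]| = #|codom slot|.
    apply: eq_card => s; rewrite inE; apply/idP/codomP => [h|[p ->]].
      by exists (unslot s); rewrite unslotK.
    exact: is_slot_slot.
  by rewrite card_codom ?card_prod ?card_ord ?mulnn //; exact: slot_inj.
have cU : #|[pred s | is_tau_slot s]| = n.
  have -> : #|[pred s | is_tau_slot s]| = #|codom tau_slot|.
    apply: eq_card => s; rewrite inE; apply/is_tau_slotP/codomP => -[j ->];
      by exists j.
  by rewrite card_codom ?card_ord //; exact: tau_slot_inj.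
have := cardC [pred s | is_slot s]; rewrite cT cS => e1.
have e2 : (#|[pred s : triple | is_free s]| + #|[pred s | is_tau_slot s]|
    = #|[predC [pred s | is_slot s]]|)%N.
  rewrite -(cardID [pred s | is_tau_slot s] [predC [pred s | is_slot s]]) addnC.
  congr (_ + _)%N; apply: eq_card => s; rewrite !inE //=.
    by move: (@slot_not_tau s); case: (is_slot s); case: (is_tau_slot s) => //= /(_ isT).
  by rewrite /is_free; case: (is_slot s); case: (is_tau_slot s).
by rewrite -e1 addKn -e2 cU addnK.
Qed.

(** The coordinate expression of tau(d_j): the bracket term vanishes because coordinate fields
    commute. *)
Definition tau_of (g : triple -> R) j := \sum_i (g (i, j, i) - g (j, i, i)).

(** With 0 at the tau slots, [tau_of] of this family is the part of tau(d_j) known before the tau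
    slot is solved for. *)
Definition tau_free (f : triple -> R) (u : 'I_n * 'I_n -> R) s : R :=
  if is_slot s then u (unslot s) else if is_tau_slot s then 0 else f s.

(** The signs reflect that G^t_tj occurs in tau(d_j) with coefficient 1, and G^o_to in tau(d_t) with
    coefficient -1. *)
Definition assemble (f : triple -> R) (u : 'I_n * 'I_n -> R) s : R :=
  if is_slot s then u (unslot s) else
  if is_tau_slot s then
    (if s.2 == t then - tau_of (tau_free f u) s.1.2 else tau_of (tau_free f u) t)
  else f s.

Lemma assemble_slot f u p : assemble f u (slot p) = u p.
Proof. by rewrite /assemble is_slot_slot slotK. Qed.

Lemma assemble_free f u s : is_free s -> assemble f u s = f s.
Proof. by rewrite /assemble => /andP[/negbTE -> /negbTE ->]. Qed.

Lemma eq_tau_free f u s : ~~ is_tau_slot s -> assemble f u s = tau_free f u s.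
Proof. by rewrite /assemble /tau_free => /negbTE ->. Qed.

(* tau_of g j only involves the tau-slot tau_slot j.                           *)
Lemma tau_of_split (g h : triple -> R) j :
  (forall s, ~~ is_tau_slot s -> g s = h s) -> h (tau_slot j) = 0 ->
  tau_of g j = (if j != t then g (t, j, t) else - g (t, o, o)) + tau_of h j.
Proof.
move=> gh h0; rewrite /tau_of.
case: (eqVneq j t) h0 => [->|jt] /=; rewrite /tau_slot ?eqxx ?jt /= => h0.
  rewrite (bigD1 o) //= [in RHS](bigD1 o) //= h0 subr0 addrA; congr (_ + _).
    rewrite addrC -gh // /is_tau_slot /=.
    by rewrite (negbTE ot).
  apply: eq_bigr => i io; case: (eqVneq i t) => [->|it]; first by rewrite !subrr.
  by rewrite !gh // /is_tau_slot /= ?eqxx ?(negbTE it) ?(negbTE io).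
rewrite (bigD1 t) //= [in RHS](bigD1 t) //= h0 sub0r addrA; congr (_ + _).
  by rewrite [g (j, t, t)]gh // /is_tau_slot /= (negbTE jt).
apply: eq_bigr => i it.
by rewrite !gh // /is_tau_slot /= ?(negbTE it) ?(negbTE jt).
Qed.

Lemma tau_free_tau_slot f u j : tau_free f u (tau_slot j) = 0.
Proof.
have h : is_tau_slot (tau_slot j) by apply/is_tau_slotP; exists j.
rewrite /tau_free h; case: ifP => // s.
by have := slot_not_tau s; rewrite h.
Qed.

Lemma assemble_tau f u j : tau_of (assemble f u) j = 0.
Proof.
rewrite (tau_of_split (@eq_tau_free f u) (tau_free_tau_slot f u j)).
case: (eqVneq j t) => [->|jt] /=; rewrite /assemble /is_slot /is_tau_slot /=.
  by rewrite !eqxx (negbTE ot) [t == o]eq_sym (negbTE ot) /= addNr.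
by rewrite !eqxx [t == o]eq_sym (negbTE ot) jt /= addNr.
Qed.

(** By [tau_of_split] each trace equation has a single tau slot as unknown, with an invertible
    coefficient. *)
Lemma assemble_unique f u g : (forall j, tau_of g j = 0) ->
  (forall s, is_free s -> g s = f s) -> (forall p, g (slot p) = u p) ->
  g = assemble f u.
Proof.
move=> g0 gf gu.
have gh s : ~~ is_tau_slot s -> g s = tau_free f u s.
  rewrite /tau_free => ts; case: ifP => ss; first by rewrite -gu unslotK.
  by rewrite (negbTE ts) gf // /is_free ss.
apply/funext => s; case: (boolP (is_tau_slot s)) => [/is_tau_slotP [j ->]|ts]; last first.
  by rewrite gh // eq_tau_free.
have h : is_tau_slot (tau_slot j) by apply/is_tau_slotP; exists j.
have h' : is_slot (tau_slot j) = false.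
  by apply/negbTE; apply: contraTN h; exact: slot_not_tau.
have := tau_of_split gh (tau_free_tau_slot f u j).
rewrite g0 /assemble h h' /tau_slot => /esym.
case: (eqVneq j t) => [->|jt] /=; rewrite ?eqxx ?(negbTE ot) => /eqP.
  by rewrite addrC subr_eq0 => /eqP ->.
by rewrite addr_eq0 => /eqP.
Qed.

Lemma assemble_bound f u C : (forall s, `|f s| <= C) -> (forall p, `|u p| <= C) ->
  forall s, `|assemble f u s| <= (2 * n)%:R * C.
Proof.
move=> hf hu s; have C0 : 0 <= C by apply: le_trans (hf s).
have n0 : (0 < n)%N by case: (n) (t) => // -[].
have le1 x : `|x| <= C -> `|x| <= (2 * n)%:R * C.
  by move=> xC; apply: le_trans xC _; rewrite ler_peMl // ler1n muln_gt0.
have tf s' : `|tau_free f u s'| <= C.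
  by rewrite /tau_free; case: ifP => // _; case: ifP => // _; rewrite normr0.
have tb j : `|tau_of (tau_free f u) j| <= (2 * n)%:R * C.
  apply: (le_trans (ler_norm_sum _ _ _)).
  apply: (@le_trans _ _ (\sum_(i < n) (C + C))).
    apply: ler_sum => i _; apply: (le_trans (ler_normB _ _)); exact: lerD.
  rewrite sumr_const card_ord -[leLHS]mulr_natr natrM.
  by rewrite le_eqVlt; apply/orP; left; apply/eqP; ring.
rewrite /assemble; case: ifP => _; first exact: le1.
case: ifP => _; last exact: le1.
by case: ifP => _; rewrite ?normrN.
Qed.

End Slots.

(** * The Ricci equation as an evolution system in the direction t *)

Section JetRicci.
Variables (R : realType) (n : nat) (t o : 'I_n).
Hypothesis ot : o != t.
Let triple := ('I_n * 'I_n * 'I_n)%type.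
Implicit Types (s : triple) (i j k : 'I_n) (G : triple -> jet R n) (w : seq 'I_n).

Definition ricci_quad G i j : jet R n := fun w =>
  \sum_k \sum_l (jmul (G (i, j, l)) (G (k, l, k)) w - jmul (G (k, j, l)) (G (i, l, k)) w).

Definition ricci_jet G i j : jet R n := fun w =>
  \sum_k (G (i, j, k) (k :: w) - G (k, j, k) (i :: w)) + ricci_quad G i j w.

(* The value of d_t of slot (i, j) according to Ric = r.                       *)
Definition ricci_rhs (r : 'I_n -> 'I_n -> jet R n) G (p : 'I_n * 'I_n) : jet R n :=
  fun w => if p.1 != t then
      r p.1 p.2 w - \sum_(k | k != t) G (p.1, p.2, k) (k :: w)
      + \sum_k G (k, p.2, k) (p.1 :: w) - ricci_quad G p.1 p.2 w
    else \sum_(k | k != t) G (t, p.2, k) (k :: w)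
      - \sum_(k | (k != t) && (k != o)) G (k, p.2, k) (t :: w)
      + ricci_quad G t p.2 w - r t p.2 w.

Lemma ricci_rhsP r G i j w : ricci_jet G i j w = r i j w <->
  G (slot t o (i, j)) (t :: w) = ricci_rhs r G (i, j) w.
Proof.
rewrite /ricci_jet /ricci_rhs /slot /=; case: (eqVneq i t) => [->|it] /=.
  (* The two occurrences of d_t G^t_tj cancel; splitting off o then isolates the unknown d_t
     G^o_oj. *)
  rewrite sumrB (bigD1 t) //= [X in _ - X + _](bigD1 t) //= [X in _ - (_ + X) + _](bigD1 o) //=.
  set a := \sum_(i0 < n | _) _; set b := \sum_(i0 < n | _) _; set q := ricci_quad _ _ _ _.
  split=> [<-|->]; ring.
rewrite sumrB (bigD1 t) //=.
set a := \sum_(i0 < n | _) _; set b := \sum_(i0 < n) _; set q := ricci_quad _ _ _ _.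
by split=> [<-|->]; ring.
Qed.

(** The trace equations are linear with constant coefficients, so they can be solved word by
    word. *)
Definition assemble_jets (f : triple -> jet R n) (U : 'I_n * 'I_n -> jet R n) :
    triple -> jet R n :=
  fun s w => assemble t o (fun s' => f s' w) (fun p => U p w) s.

Lemma assemble_jets_local f c U U' : (forall p, agree_upto t c (U p) (U' p)) ->
  forall s, agree_upto t c (assemble_jets f U s) (assemble_jets f U' s).
Proof.
move=> h s w cw; rewrite /assemble_jets; congr (assemble _ _ _ _ _).
by apply/funext => p; apply: h.
Qed.

Lemma assemble_jets_symmetric f U : (forall s, symmetric_jet (f s)) ->
  (forall p, symmetric_jet (U p)) -> forall s, symmetric_jet (assemble_jets f U s).
Proof.
move=> sf sU s w w' p; rewrite /assemble_jets; congr (assemble _ _ _ _ _).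
  by apply/funext => s'; apply: sf.
by apply/funext => q; apply: sU.
Qed.

Lemma ricci_quad_symmetric G i j : (forall s, symmetric_jet (G s)) ->
  symmetric_jet (ricci_quad G i j).
Proof.
move=> sG w w' p; apply: eq_bigr => k _; apply: eq_bigr => l _.
by rewrite !(jmul_symmetric (sG _) (sG _) p).
Qed.

Lemma ricci_rhs_symmetric r G p : (forall i j, symmetric_jet (r i j)) ->
  (forall s, symmetric_jet (G s)) -> symmetric_jet (ricci_rhs r G p).
Proof.
move=> sr sG w w' pw; rewrite /ricci_rhs.
rewrite !(sr _ _ _ _ pw) !(ricci_quad_symmetric _ _ sG pw).
have h s k : G s (k :: w) = G s (k :: w') by apply: sG; rewrite perm_cons.
case: ifP => _.
  by congr (_ - _ + _ - _); apply: eq_bigr => k _; rewrite h.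
by congr (_ - _ + _ - _); apply: eq_bigr => k _; rewrite h.
Qed.

(** The symbols whose d_t survives in the equations for i = t are prescribed data, not unknowns. *)
Lemma free_diag k j : k != t -> k != o -> is_free t o (k, j, k).
Proof.
by move=> kt ko; rewrite /is_free /is_slot /is_tau_slot /= (negbTE kt) (negbTE ko).
Qed.

(** Derivatives of assembled symbols are taken along tangential letters, which do not raise the
    count of t; the only d_t left falls on free symbols ([free_diag]). *)
Lemma ricci_rhs_local r f : local t (fun U => ricci_rhs r (assemble_jets f U)).
Proof.
move=> c U U' h p w cw; have hG := @assemble_jets_local f _ _ _ h.
have hq i j : ricci_quad (assemble_jets f U) i j w = ricci_quad (assemble_jets f U') i j w.
  apply: eq_bigr => k _; apply: eq_bigr => l _.
  by congr (_ - _); apply: (agree_jmul _ _ cw); exact: hG.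
have ck k : k != t -> (count_mem t (k :: w) <= c)%N.
  by move=> kt /=; rewrite (negbTE kt).
rewrite /ricci_rhs !hq; case: ifPn => [pt|_].
  by congr (_ - _ + _ - _); apply: eq_bigr => k kt; apply: hG; exact: ck.
congr (_ - _ + _ - _); apply: eq_bigr => k kt; first by apply: hG; exact: ck.
case/andP: kt => kt ko.
by rewrite /assemble_jets !assemble_free // free_diag.
Qed.

Lemma jets_unique r G G' :
  (forall s, symmetric_jet (G s)) -> (forall s, symmetric_jet (G' s)) ->
  (forall j w, tau_of (fun s => G s w) j = 0) ->
  (forall j w, tau_of (fun s => G' s w) j = 0) ->
  (forall i j w, ricci_jet G i j w = r i j w) ->
  (forall i j w, ricci_jet G' i j w = r i j w) ->
  (forall s, is_free t o s -> G s = G' s) ->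
  (forall p w, t \notin w -> G (slot t o p) w = G' (slot t o p) w) -> G = G'.
Proof.
move=> sG sG' tG tG' rG rG' hf h0.
pose U p := G (slot t o p); pose U' p := G' (slot t o p).
have GE : G = assemble_jets G U.
  by apply/funext => s; apply/funext => w; rewrite /assemble_jets
    -(@assemble_unique R n t o ot _ _ (fun s => G s w)).
have GE' : G' = assemble_jets G U'.
  apply/funext => s; apply/funext => w; rewrite /assemble_jets.
  rewrite -(@assemble_unique R n t o ot _ _ (fun s => G' s w)) //.
  by move=> s' fs; rewrite hf.
suff UU : forall p, U p = U' p.
  by rewrite GE GE'; congr assemble_jets; apply/funext.
apply: (cauchy_problem_unique (@ricci_rhs_local r G)) => //.
- by move=> p; exact: sG.
- by move=> p; exact: sG'.
- by move=> [i j] w; rewrite -GE; apply/ricci_rhsP.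
- by move=> [i j] w; rewrite -GE'; apply/ricci_rhsP.
Qed.

Section Existence.
Variables (r : 'I_n -> 'I_n -> jet R n) (f : triple -> jet R n).
Variables (psi : 'I_n * 'I_n -> jet R n).
Hypotheses (r_sym : forall i j, symmetric_jet (r i j)).
Hypotheses (f_sym : forall s, symmetric_jet (f s)).
Hypotheses (psi_sym : forall p, symmetric_jet (psi p)).
Variables (M mu : R).
Hypotheses (M0 : 0 <= M) (mu1 : 1 <= mu).
Hypotheses (r_bounded : forall i j, jet_bounded M mu (r i j)).
Hypotheses (f_bounded : forall s, jet_bounded M mu (f s)).
Hypotheses (psi_bounded : forall p, jet_bounded M mu (psi p)).

Let N : R := n%:R.
Let lam : R := 4 * mu.
(** The summands pay, in order, for r, for the two sums of tangential derivatives, for d_t of the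
    free symbols and for the quadratic terms. The factor M in the last one is due to their degree
    two. *)
Let K : R := 4 + 2 * N ^+ 2 + 2 * N ^+ 2 + N + 256 * N ^+ 4 * M.
Let om := weight t lam K.

Let N0 : 0 <= N. Proof. exact: ler0n. Qed.
Let lam1 : 1 <= lam. Proof. by rewrite /lam; move: mu1; lra. Qed.
Let mu0 : 0 <= mu. Proof. by move: mu1; lra. Qed.
Let K1 : 1 <= K.
Proof.
have h1 : 0 <= N ^+ 2 by exact: exprn_ge0.
have h2 : 0 <= 256 * N ^+ 4 * M by rewrite !mulr_ge0 // exprn_ge0.
by rewrite /K; move: N0 h1 h2; lra.
Qed.
Let K0 : 0 < K. Proof. exact: lt_le_trans K1. Qed.

Let om0 w : 0 < om w. Proof. exact: weight_gt0. Qed.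

Let ricci_rhs_bound U : (forall p, symmetric_jet (U p)) ->
  (forall p w, `|U p w| <= M * om w) ->
  forall p w, `|ricci_rhs r (assemble_jets f U) p w| <= M * om (t :: w).
Proof.
move=> _ hU p w; set G := assemble_jets f U.
have fb s v : `|f s v| <= M * om v by apply: (weight_data_le _ lam1 K1 _ M0 mu0).
have hG s v : `|G s v| <= 2 * N * M * om v.
  rewrite -mulrA -[2 * N]natrM; exact: assemble_bound.
have NM : 0 <= 2 * N * M by rewrite !mulr_ge0.
have hGk s k : k != t -> `|G s (k :: w)| <= 2 * N * M / K * om (t :: w).
  move=> kt; rewrite -mulrA -(weight_cons_tangential _ K1 _ kt); exact: hG.
pose W := om (t :: w); have W0 : 0 <= W by exact/ltW/om0.
have wW : om w <= 4 / K * W by exact: weight_le_cons.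
have hr i j : `|r i j w| <= 4 * M / K * W.
  apply: (@le_trans _ _ (M * om w)); first exact: (weight_data_le _ lam1 K1 _ M0 mu0).
  apply: (@le_trans _ _ (M * (4 / K * W))); first by rewrite ler_wpM2l.
  by rewrite le_eqVlt; apply/orP; left; apply/eqP; ring.
have sumb (P : pred 'I_n) (F : 'I_n -> R) c : 0 <= c ->
    (forall k, P k -> `|F k| <= c) -> `|\sum_(k | P k) F k| <= N * c.
  move=> c0 hF; apply: (le_trans (ler_norm_sum _ _ _)).
  apply: (@le_trans _ _ (\sum_(k < n) c)).
    by rewrite big_mkcond; apply: ler_sum => k _; case: ifP => // /hF.
  by rewrite sumr_const card_ord -[leLHS]mulr_natl.
have hq i j : `|ricci_quad G i j w| <= 256 * N ^+ 4 * M ^+ 2 / K * W.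
  have hj s s' : `|jmul (G s) (G s') w| <= 8 * (2 * N * M) * (2 * N * M) * om w.
    by apply: (weight_jmul lam1 K1).
  have B0 : 0 <= 8 * (2 * N * M) * (2 * N * M) * om w.
    by apply: mulr_ge0; [rewrite !mulr_ge0|exact: ltW].
  set B := 8 * _ * _ * _ in hj B0.
  apply: (@le_trans _ _ (N * (N * (B + B)))).
    apply: (sumb) => [|k _]; first by rewrite mulr_ge0 // addr_ge0.
    apply: (sumb) => [|l _]; first by rewrite addr_ge0.
    by apply: (le_trans (ler_normB _ _)); exact: lerD.
  have -> : N * (N * (B + B)) = 64 * N ^+ 4 * M ^+ 2 * om w by rewrite /B; ring.
  apply: (@le_trans _ _ (64 * N ^+ 4 * M ^+ 2 * (4 / K * W))).
    by rewrite ler_wpM2l // !mulr_ge0 // exprn_ge0.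
  by rewrite le_eqVlt; apply/orP; left; apply/eqP; ring.
(* By the choice of K the five bounds add up to exactly M W, so the constant M is reproduced. *)
have total : (4 * M / K * W + N * (2 * N * M / K * W) + N * (2 * N * M / K * W)
    + N * (M / K * W) + 256 * N ^+ 4 * M ^+ 2 / K * W) = M * W.
  have kK : K^-1 * (4 + 2 * N ^+ 2 + 2 * N ^+ 2 + N + 256 * N ^+ 4 * M) = 1.
    by rewrite -/K mulVf // gt_eqF.
  move: (K^-1) kK => k kK; rewrite -[RHS]mulr1 -[X in _ = _ * X]kK; ring.
have c1 : 0 <= 2 * N * M / K * W by rewrite mulr_ge0 // divr_ge0 // ltW.
have c2 : 0 <= N * (M / K * W) by rewrite mulr_ge0 // mulr_ge0 // divr_ge0 // ltW.
have c3 : 0 <= N * (2 * N * M / K * W) by rewrite mulr_ge0.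
rewrite -/W -total /ricci_rhs; case: ifPn => [pt|_].
  have s1 := sumb (fun k => k != t) (fun k => G (p.1, p.2, k) (k :: w)) _ c1
    (fun k kt => hGk _ _ kt).
  have s2 := sumb xpredT (fun k => G (k, p.2, k) (p.1 :: w)) _ c1
    (fun k _ => hGk _ _ pt).
  have s3 := hr p.1 p.2; have s4 := hq p.1 p.2.
  move: s1 s2 s3 s4; rewrite !ler_norml; lra.
have s1 := sumb (fun k => k != t) (fun k => G (t, p.2, k) (k :: w)) _ c1
    (fun k kt => hGk _ _ kt).
have s2 : `|\sum_(k | (k != t) && (k != o)) G (k, p.2, k) (t :: w)| <= N * (M / K * W).
  apply: (sumb) => [|k /andP[kt ko]]; first by rewrite mulr_ge0 // divr_ge0 // ltW.
  rewrite /G /assemble_jets assemble_free ?free_diag //.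
  exact: (weight_data_cons _ lam1 K1 _ M0 mu0).
have s3 := hr t p.2; have s4 := hq t p.2.
move: s1 s2 s3 s4; rewrite !ler_norml; lra.
Qed.

Lemma jets_exist : exists G : triple -> jet R n,
  [/\ forall s, symmetric_jet (G s), forall s, exp_bounded (G s),
      (forall s, is_free t o s -> G s = f s),
      (forall p w, t \notin w -> G (slot t o p) w = psi p w) &
      (forall j w, tau_of (fun s => G s w) j = 0) /\
      (forall i j w, ricci_jet G i j w = r i j w)].
Proof.
have [||||||U [sU bU U0 eU]] := @cauchy_problem_exists R n t ('I_n * 'I_n)%type _
    (@ricci_rhs_local r f) psi om M.
- by move=> U sU p; apply: ricci_rhs_symmetric => // s; exact: assemble_jets_symmetric.
- by move=> w w'; exact: weight_perm.
- by move=> w; rewrite mulr_ge0 // ltW.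
- exact: ricci_rhs_bound.
- exact: psi_sym.
- by move=> p w; apply: (weight_data_le _ lam1 K1 _ M0 mu0).
exists (assemble_jets f U); split.
- exact: assemble_jets_symmetric.
- move=> s; apply: (@weight_exp_bounded R n t lam K lam1 K1 (2 * N * M)).
    by rewrite !mulr_ge0.
  move=> v.
  have -> : 2 * N * M * weight t lam K v = (2 * n)%:R * (M * om v).
    by rewrite natrM !mulrA.
  apply: assemble_bound => // s'.
  exact: (weight_data_le _ lam1 K1 _ M0 mu0).
- by move=> s fs; apply/funext => w; rewrite /assemble_jets assemble_free.
- by move=> p w tw; rewrite /assemble_jets assemble_slot ?U0.
split=> [j w|i j w]; first exact: assemble_tau.
by apply/ricci_rhsP; rewrite {1}/assemble_jets assemble_slot.
Qed.

End Existence.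

End JetRicci.

(** * Restriction to the hyperplane and analytic germs *)

Section Hyperplane.
Variables (R : realType) (m : nat).
Implicit Types (V W : jet R m.+1) (f : 'rV[R]_m.+1 -> R).

Let widen : 'I_m -> 'I_m.+1 := widen_ord (leqnSn m).
Let unwiden (i : 'I_m.+1) : option 'I_m := insub (i : nat).

Definition restrict_jet V : jet R m := fun w => V (map widen w).

(** The jet of the extension that is constant in the last variable. *)
Definition extend_jet (V : jet R m) : jet R m.+1 :=
  fun w => if ord_max \in w then 0 else V (pmap unwiden w).

Let widenK : pcancel widen unwiden.
Proof. by move=> i; rewrite /unwiden /widen /= valK. Qed.

Let unwiden_max : unwiden ord_max = None.
Proof. by rewrite /unwiden insubF //= ltnn. Qed.

Let widen_max i : (ord_max == widen i) = false.
Proof. by rewrite -val_eqE /= gtn_eqF. Qed.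

Let map_widen_max w : ord_max \notin map widen w.
Proof. by apply/mapP => -[i _ /eqP]; rewrite widen_max. Qed.

Let pmap_unwidenK w : ord_max \notin w -> map widen (pmap unwiden w) = w.
Proof.
elim: w => [//|i w IH]; rewrite inE negb_or => /andP[im /IH {}IH].
have lim : (i < m)%N by rewrite ltn_neqAle -ltnS ltn_ord andbT -val_eqE eq_sym in im *.
have e : unwiden i = Some (Ordinal lim) by exact: insubT.
by rewrite /= e /= IH; congr (_ :: _); exact/val_inj.
Qed.

Lemma restrict_extend (V : jet R m) : restrict_jet (extend_jet V) = V.
Proof.
apply/funext => w; rewrite /restrict_jet /extend_jet (negbTE (map_widen_max w)).
by rewrite (map_pK widenK).
Qed.

Lemma restrict_inj V W : restrict_jet V = restrict_jet W ->
  forall w, ord_max \notin w -> V w = W w.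
Proof.
move=> h w wm; rewrite -(pmap_unwidenK wm).
exact: (congr1 (fun U : jet R m => U (pmap unwiden w)) h).
Qed.

Lemma restrict_eq V (W : jet R m) : (forall w, ord_max \notin w -> V w = extend_jet W w) ->
  restrict_jet V = W.
Proof.
move=> h; rewrite -[RHS]restrict_extend; apply/funext => w; apply: h.
exact: map_widen_max.
Qed.

Lemma extend_symmetric (V : jet R m) : symmetric_jet V -> symmetric_jet (extend_jet V).
Proof.
move=> sV w w' p; rewrite /extend_jet (perm_mem p); case: ifP => // _.
by apply: sV; exact: perm_pmap.
Qed.

Lemma extend_exp_bounded (V : jet R m) : exp_bounded V -> exp_bounded (extend_jet V).
Proof.
case=> M [l [M0 l1' bV]]; exists M, l; split=> // w; rewrite /extend_jet.
have l0 : 0 <= l by apply: le_trans l1'.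
case: ifPn => wm; first by rewrite normr0 !mulr_ge0 ?exprn_ge0.
apply: (le_trans (bV _)).
by rewrite -[in leRHS](pmap_unwidenK wm) size_map.
Qed.

Lemma hyperplane_pointE (y : 'rV[R]_m) i :
  @hyperplane_point R m.+1 y 0 (widen i) = y 0 i.
Proof. by rewrite mxE -[insub _]/(unwiden (widen i)) widenK. Qed.

Lemma hyperplane_point_max (y : 'rV[R]_m) : @hyperplane_point R m.+1 y 0 ord_max = 0.
Proof. by rewrite mxE -[insub _]/(unwiden ord_max) unwiden_max. Qed.

Lemma hom_restrict k V (y : 'rV[R]_m) :
  hom k V (@hyperplane_point R m.+1 y) = hom k (restrict_jet V) y.
Proof.
elim: k V => [//|k IH] V /=; rewrite big_ord_recr /= hyperplane_point_max mul0r addr0.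
by apply: eq_bigr => i _; rewrite hyperplane_pointE IH.
Qed.

Lemma near_hyperplane (P : set 'rV[R]_m.+1) : (\forall x \near (0 : 'rV[R]_m.+1), P x) ->
  \forall y \near (0 : 'rV[R]_m), P (@hyperplane_point R m.+1 y).
Proof.
move=> /nbhs_norm0P [d /= d0 hd]; apply: filterS (@near_l1 R m d d0) => y yd.
apply: hd; apply: le_lt_trans yd.
rewrite [leLHS]/Num.Def.normr /= mx_normrE.
apply: bigmax_le => [|[i j] _ /=]; first exact: l1_ge0.
rewrite ord1; case: (unliftP ord_max j) => [k ->|->]; last first.
  by rewrite hyperplane_point_max normr0 l1_ge0.
have -> : lift ord_max k = widen k by apply/val_inj; exact: lift_max.
by rewrite hyperplane_pointE /l1 (bigD1 k) //= lerDl sumr_ge0.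
Qed.

Lemma taylor_restrict V f : taylor V f ->
  taylor (restrict_jet V) (f \o @hyperplane_point R m.+1).
Proof.
move=> [sV [M [l [M0 l1' bV]]] cV]; split.
- by move=> w w' p; apply: sV; exact: perm_map.
- by exists M, l; split=> // w; apply: le_trans (bV _) _; rewrite size_map.
apply: filterS (near_hyperplane cV) => y; rewrite /taylor_sum.
by under eq_fun do rewrite hom_restrict.
Qed.

End Hyperplane.

(** * Closure properties of analytic germs *)

Section AnalyticFunctions.
Variables (R : realType) (n : nat).
Implicit Types (f g : 'rV[R]_n -> R) (X Y : vector_field R n).

Lemma analytic_cst (c : R) : analytic (fun _ : 'rV[R]_n => c).
Proof. exact: taylor_analytic (taylor_cst n c). Qed.

Lemma analyticD f g : analytic f -> analytic g -> analytic (fun x => f x + g x).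
Proof.
move=> /analytic_taylor [V tV] /analytic_taylor [W tW].
exact: taylor_analytic (taylorD tV tW).
Qed.

Lemma analyticM f g : analytic f -> analytic g -> analytic (fun x => f x * g x).
Proof.
move=> /analytic_taylor [V tV] /analytic_taylor [W tW].
exact: taylor_analytic (taylorM tV tW).
Qed.

Lemma analytic_sum (I : Type) (s : seq I) (f : I -> 'rV[R]_n -> R) :
  (forall i, analytic (f i)) -> analytic (fun x => \sum_(i <- s) f i x).
Proof.
move=> af; have [V tV] := choice (fun i => analytic_taylor (af i)).
by apply: taylor_analytic; apply: taylor_sumP => i _; exact: tV.
Qed.

Lemma analytic_partial i f : analytic f -> analytic (partial i f).
Proof. by move=> /analytic_taylor [V tV]; exact: taylor_analytic (taylor_shift i tV). Qed.

Lemma near_analytic f g : analytic f ->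
  (\forall x \near (0 : 'rV[R]_n), f x = g x) -> analytic g.
Proof.
by move=> /analytic_taylor [V tV] fg; exact: taylor_analytic (near_taylor tV fg).
Qed.

Lemma analytic_derive f : analytic f -> \forall x \near (0 : 'rV[R]_n),
  forall v, derivable f x v /\ 'D_v f x = \sum_(i < n) v 0 i * partial i f x.
Proof. by move=> /analytic_taylor [V tV]; exact: taylor_derive tV. Qed.

Lemma taylor_eq (V : jet R n) f g : taylor V f -> taylor V g ->
  \forall x \near (0 : 'rV[R]_n), f x = g x.
Proof. by move=> /near_ev tf /near_ev tg; apply: filterS2 tf tg => x -> ->. Qed.

Lemma analytic_coord_field i : analytic_field (coord_field i : vector_field R n).
Proof. by move=> k; exact: analytic_cst. Qed.

Lemma analytic_field_derive X : analytic_field X -> \forall x \near (0 : 'rV[R]_n),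
  forall v k, [/\ derivable (fun y => X y 0 k) x v,
    'D_v (fun y => X y 0 k) x = \sum_(i < n) v 0 i * partial i (fun y => X y 0 k) x &
    ('D_v X x) 0 k = 'D_v (fun y => X y 0 k) x].
Proof.
move=> aX; have h k := analytic_derive (aX k).
have {}h := filter_forall (nbhs_filter (0 : 'rV[R]_n)) h.
apply: filterS h => x hx v k; have [d e] := hx k v; split=> //.
rewrite derive_mx ?mxE //; apply/derivable_mxP => i j; rewrite ord1.
by have [] := hx j v.
Qed.

End AnalyticFunctions.

(** * Connections and Christoffel symbols *)

Section ConnectionFromChristoffel.
Variables (R : realType) (n : nat).
Variable (g : 'I_n * 'I_n * 'I_n -> 'rV[R]_n -> R).
Hypothesis g_analytic : forall s, analytic (g s).
Implicit Types (X Y : vector_field R n).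

Definition connection_of : operator R n := fun X Y x =>
  \row_k ('D_(X x) (fun y => Y y 0 k) x
    + \sum_i \sum_j X x 0 i * Y x 0 j * g (i, j, k) x).

Lemma connection_ofP : linear_connection connection_of.
Proof.
split.
- move=> X Y aX aY k.
  apply: (@near_analytic _ _ (fun x =>
      \sum_i X x 0 i * partial i (fun y => Y y 0 k) x
      + \sum_i \sum_j X x 0 i * Y x 0 j * g (i, j, k) x)).
    apply: analyticD; apply: analytic_sum => i.
      by apply: analyticM => //; exact: analytic_partial.
    apply: analytic_sum => j; apply: analyticM => //; exact: analyticM.
  apply: filterS (analytic_field_derive aY) => x hx.
  by rewrite mxE; have [_ ->] := hx (X x) k.
- move=> X X' Y Y' _ _ _ _ nX nY.
  apply: filterS3 nX nY (near_join nY) => x Xx Yx nYx.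
  apply/rowP => k; rewrite !mxE Xx Yx; congr (_ + _).
  by apply: near_eq_derive; apply: filterS nYx => y ->.
- move=> X X' Y _ _ aY; apply: filterS (analytic_field_derive aY) => x hx.
  apply/rowP => k; rewrite !mxE.
  have d v : 'D_v (fun y => Y y 0 k) x =
      \sum_(i < n) v 0 i * partial i (fun y => Y y 0 k) x by have [] := hx v k.
  rewrite !d addrACA; congr (_ + _); rewrite -big_split; apply: eq_bigr => i _ /=.
    by rewrite !mxE mulrDl.
  rewrite -big_split /=; apply: eq_bigr => j _.
  by rewrite !mxE !mulrDl.
- move=> f X Y _ _ aY; apply: filterS (analytic_field_derive aY) => x hx.
  apply/rowP => k; rewrite !mxE.
  have d v : 'D_v (fun y => Y y 0 k) x =
      \sum_(i < n) v 0 i * partial i (fun y => Y y 0 k) x by have [] := hx v k.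
  rewrite !d mulrDr !mulr_sumr; congr (_ + _); apply: eq_bigr => i _.
    by rewrite !mxE mulrA.
  rewrite mulr_sumr; apply: eq_bigr => j _.
  by rewrite !mxE !mulrA.
- move=> X Y Y' _ aY aY'.
  apply: filterS2 (analytic_field_derive aY) (analytic_field_derive aY') => x hx hx'.
  apply/rowP => k; rewrite !mxE.
  have -> : (fun y => (Y y + Y' y) 0 k) = (fun y => Y y 0 k) + (fun y => Y' y 0 k).
    by apply/funext => y; rewrite mxE.
  have [d _ _] := hx (X x) k; have [d' _ _] := hx' (X x) k.
  rewrite deriveD // addrACA -big_split /=; congr (_ + _); apply: eq_bigr => i _.
  rewrite -big_split /=; apply: eq_bigr => j _.
  by rewrite !mxE; ring.
- move=> f X Y af _ aY.
  apply: filterS2 (analytic_derive af) (analytic_field_derive aY) => x hf hx.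
  apply/rowP => k; rewrite !mxE.
  have -> : (fun y => (f y *: Y y) 0 k) = f * (fun y => Y y 0 k).
    by apply/funext => y; rewrite mxE.
  have [d _ _] := hx (X x) k; have [d' _] := hf (X x).
  rewrite deriveM // [_ *: 'D__ _ _ + _]addrC -addrA; congr (_ + _).
    by rewrite mulrC.
  rewrite mulrDr; congr (_ + _); rewrite mulr_sumr; apply: eq_bigr => i _.
  rewrite mulr_sumr; apply: eq_bigr => j _.
  by rewrite !mxE; ring.
Qed.

Lemma christoffel_connection_of i j k : christoffel connection_of i j k = g (i, j, k).
Proof.
apply/funext => x; rewrite /christoffel mxE /coord_field derive_cst add0r.
rewrite (bigD1 i) //= [X in _ + X]big1 ?addr0; last first.
  move=> i' ii'; rewrite big1 // => j' _.
  by rewrite !mxE eqxx (negbTE ii') /= !mul0r.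
rewrite (bigD1 j) //= [X in _ + X]big1 ?addr0; last first.
  by move=> j' jj'; rewrite !mxE eqxx (negbTE jj') /= mulr0 mul0r.
by rewrite !mxE !eqxx !mul1r.
Qed.

(** The derivatives of Y in the connection and in the bracket cancel, so tau is tensorial and its
    values on coordinate fields suffice. *)
Lemma tau_connection_of Y : analytic_field Y -> \forall x \near (0 : 'rV[R]_n),
  tau connection_of Y x = \sum_j Y x 0 j * tau_of (fun s => g s x) j.
Proof.
move=> aY; apply: filterS (analytic_field_derive aY) => x hx.
rewrite /tau /mxtrace.
rewrite (eq_bigr (fun i => \sum_j Y x 0 j * (g (i, j, i) x - g (j, i, i) x))).
  by rewrite exchange_big; apply: eq_bigr => j _; rewrite mulr_sumr.
move=> i _.
have n1 : connection_of (coord_field i) Y x 0 i =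
    'D_(delta_mx 0 i) (fun y => Y y 0 i) x + \sum_j Y x 0 j * g (i, j, i) x.
  rewrite mxE; congr (_ + _); rewrite (bigD1 i) //= [X in _ + X]big1 ?addr0.
    by apply: eq_bigr => j _; rewrite mxE !eqxx mul1r.
  move=> i' ii'; rewrite big1 // => j' _.
  by rewrite mxE eqxx (negbTE ii') /= !mul0r.
have n2 : connection_of Y (coord_field i) x 0 i = \sum_j Y x 0 j * g (j, i, i) x.
  rewrite mxE derive_cst add0r; apply: eq_bigr => i' _.
  rewrite (bigD1 i) //= big1 ?addr0; first by rewrite mxE !eqxx mulr1.
  by move=> j ji; rewrite mxE eqxx (negbTE ji) mulr0 mul0r.
have n3 : lie_bracket (coord_field i) Y x 0 i = 'D_(delta_mx 0 i) (fun y => Y y 0 i) x.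
  have d : 'D_(Y x) (coord_field i) x = 0 :> 'rV[R]_n by exact: derive_cst.
  by have [_ _ e] := hx (delta_mx 0 i) i; rewrite /lie_bracket d subr0 -e.
have sub3 (a b c : 'rV[R]_n) : (a - b - c) 0 i = a 0 i - b 0 i - c 0 i.
  by rewrite !mxE.
rewrite mxE /torsion sub3.
rewrite n1 n2 n3 addrAC [X in X - _]addrAC subrr add0r -sumrB.
by apply: eq_bigr => j _; rewrite mulrBr.
Qed.

End ConnectionFromChristoffel.

(** * A connection is determined by its Christoffel symbols *)

Section GeneralConnection.
Variables (R : realType) (m : nat).
Implicit Types (X Y : vector_field R m.+1) (nabla : operator R m.+1).

(** Every analytic field is a finite combination of coordinate fields with analytic coefficients,
    built one summand at a time to fit the rules of a connection. *)
Lemma analytic_field_ind (Q : vector_field R m.+1 -> Prop) :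
  (forall X X', analytic_field X -> analytic_field X' -> Q X -> Q X' ->
    Q (fun y => X y + X' y)) ->
  (forall f X, analytic f -> analytic_field X -> Q X -> Q (fun y => f y *: X y)) ->
  (forall i, Q (coord_field i)) -> forall X, analytic_field X -> Q X.
Proof.
move=> QD QZ Qc X aX.
have aZ f i : analytic f -> analytic_field (fun y => f y *: coord_field i y : 'rV[R]_m.+1).
  move=> af k; under eq_fun do rewrite mxE.
  by apply: analyticM => //; exact: analytic_coord_field.
suff h (s : seq 'I_m.+1) : analytic_field (fun y => \sum_(i <- s) X y 0 i *: coord_field i y)
    /\ Q (fun y => \sum_(i <- s) X y 0 i *: coord_field i y).
  have [_] := h (index_enum 'I_m.+1); congr Q; apply/funext => y.
  by rewrite [RHS]row_sum_delta.
elim: s => [|i s [ah Qh]].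
  (* The empty sum is presented as a zero multiple of a coordinate field; this requires positive
     dimension. *)
  have -> : (fun y => \sum_(i <- [::]) X y 0 i *: coord_field i y) =
     (fun y => (0 : R) *: coord_field ord0 y).
    by apply/funext => y; rewrite big_nil scale0r.
  split; first exact: aZ (analytic_cst _ _).
  by apply: QZ => //; [exact: analytic_cst|exact: analytic_coord_field].
have -> : (fun y => \sum_(j <- i :: s) X y 0 j *: coord_field j y) =
   (fun y => X y 0 i *: coord_field i y + \sum_(j <- s) X y 0 j *: coord_field j y).
  by apply/funext => y; rewrite big_cons.
split.
  move=> k; under eq_fun do rewrite mxE.
  by apply: analyticD; [exact: aZ|exact: ah].
by apply: QD => //; [exact: aZ|apply: QZ => //; exact: analytic_coord_field].
Qed.

(** Linearity in X, then the Leibniz rule in Y, whose derivative term does not depend on the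
    connection, propagate equality from the coordinate fields. *)
Lemma same_christoffel nabla nabla' : linear_connection nabla -> linear_connection nabla' ->
  (forall i j k, \forall x \near (0 : 'rV[R]_m.+1),
     christoffel nabla i j k x = christoffel nabla' i j k x) ->
  same_connection nabla nabla'.
Proof.
move=> c c' h X Y aX aY; move: X aX.
apply: analytic_field_ind.
- move=> X X' aX aX' hX hX'.
  near=> x.
  have -> : nabla (fun y => X y + X' y) Y x = nabla X Y x + nabla X' Y x.
    by near: x; exact: (nablaDl c).
  have -> : nabla' (fun y => X y + X' y) Y x = nabla' X Y x + nabla' X' Y x.
    by near: x; exact: (nablaDl c').
  by congr (_ + _); near: x.
- move=> f X af aX hX; near=> x.
  have -> : nabla (fun y => f y *: X y) Y x = f x *: nabla X Y x.
    by near: x; exact: (nablaZl c).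
  have -> : nabla' (fun y => f y *: X y) Y x = f x *: nabla' X Y x.
    by near: x; exact: (nablaZl c').
  by congr (_ *: _); near: x.
move=> i; have aX := analytic_coord_field R i; move: Y aY.
apply: analytic_field_ind.
- move=> Y Y' aY aY' hY hY'; near=> x.
  have -> : nabla (coord_field i) (fun y => Y y + Y' y) x =
      nabla (coord_field i) Y x + nabla (coord_field i) Y' x.
    by near: x; exact: (nablaDr c).
  have -> : nabla' (coord_field i) (fun y => Y y + Y' y) x =
      nabla' (coord_field i) Y x + nabla' (coord_field i) Y' x.
    by near: x; exact: (nablaDr c').
  by congr (_ + _); near: x.
- move=> f Y af aY hY; near=> x.
  have -> : nabla (coord_field i) (fun y => f y *: Y y) x =
      'D_(coord_field i x) f x *: Y x + f x *: nabla (coord_field i) Y x.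
    by near: x; exact: (nabla_leibniz c).
  have -> : nabla' (coord_field i) (fun y => f y *: Y y) x =
      'D_(coord_field i x) f x *: Y x + f x *: nabla' (coord_field i) Y x.
    by near: x; exact: (nabla_leibniz c').
  by congr (_ + _ *: _); near: x.
move=> j; have hk := filter_forall (nbhs_filter (0 : 'rV[R]_m.+1)) (h i j).
by apply: filterS hk => x hx; apply/rowP => k; exact: hx.
Unshelve. all: by end_near. Qed.

Lemma christoffel_analytic nabla i j k : linear_connection nabla ->
  analytic (christoffel nabla i j k).
Proof.
by move=> c; apply: (nabla_analytic c); exact: analytic_coord_field.
Qed.

Lemma tau_coord_field nabla j x : tau nabla (coord_field j) x =
  tau_of (fun s => christoffel nabla s.1.1 s.1.2 s.2 x) j.
Proof.
rewrite /tau /mxtrace; apply: eq_bigr => i _; rewrite !mxE.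
have d (k l : 'I_m.+1) : 'D_(coord_field k x) (coord_field l) x = 0 :> 'rV[R]_m.+1.
  exact: derive_cst.
by rewrite !d subrr subr0.
Qed.

Variable (g : 'I_m.+1 * 'I_m.+1 * 'I_m.+1 -> 'rV[R]_m.+1 -> R).
Variable (G : 'I_m.+1 * 'I_m.+1 * 'I_m.+1 -> jet R m.+1).
Hypothesis gG : forall s, taylor (G s) (g s).

Lemma taylor_tau_of j : taylor (fun w => tau_of (fun s => G s w) j)
  (fun x => tau_of (fun s => g s x) j).
Proof. by apply: taylor_sumP => i _; exact: taylorB. Qed.

Lemma taylor_ricci nabla i j : (forall i j k, christoffel nabla i j k = g (i, j, k)) ->
  taylor (ricci_jet G i j) (fun x => ricci nabla x i j).
Proof.
move=> h; under [X in taylor _ X]eq_fun do rewrite mxE.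
apply: taylorD; apply: taylor_sumP => k _.
  by rewrite !h; apply: taylorB; exact: taylor_shift.
apply: taylor_sumP => l _; rewrite !h.
by apply: taylorB; exact: taylorM.
Qed.

End GeneralConnection.

(** * The theorem *)

Lemma cauchy_data_bounded (R : realType) (n : nat)
    (r : 'I_n -> 'I_n -> jet R n) (f : 'I_n * 'I_n * 'I_n -> jet R n)
    (psi : 'I_n * 'I_n -> jet R n) :
  (forall i j, exp_bounded (r i j)) -> (forall s, exp_bounded (f s)) ->
  (forall p, exp_bounded (psi p)) ->
  exists M mu : R, [/\ 0 <= M, 1 <= mu, forall i j, jet_bounded M mu (r i j),
    forall s, jet_bounded M mu (f s) & forall p, jet_bounded M mu (psi p)].
Proof.
move=> br bf bp.
pose J := (('I_n * 'I_n) + ('I_n * 'I_n * 'I_n) + ('I_n * 'I_n))%type.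
pose V (x : J) := match x with inl (inl p) => r p.1 p.2 | inl (inr s) => f s
  | inr p => psi p end.
have [|M [mu [M0 mu1 h]]] := @exp_bounded_family R n J V; first by move=> [[?|?]|?] /=.
exists M, mu; split=> // [i j|s|p].
- exact: (h (inl (inl (i, j)))).
- exact: (h (inl (inr s))).
- exact: (h (inr p)).
Qed.

Theorem theorem3p2 (R : realType) (n : nat) (n_ge3 : (3 <= n)%N)
    (r : tensor02 R n) (r_analytic : analytic_tensor02 r) :
  depends_bijectively
    (fun nabla : operator R n =>
       [/\ linear_connection nabla, tau_zero nabla &
           {near (0 : 'rV[R]_n), ricci nabla =1 r}])
    (n ^ 3 - n ^ 2 - n)%N (n ^ 2)%N.
Proof.
case: n n_ge3 r r_analytic => [//|m] n_ge3 r r_analytic.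
pose t : 'I_m.+1 := ord_max; pose o : 'I_m.+1 := ord0.
have ot : o != t by rewrite -val_eqE /= eq_sym -lt0n -ltnS; exact: leq_trans n_ge3.
have cp : (m.+1 ^ 2)%N = #|{: 'I_m.+1 * 'I_m.+1}| by rewrite card_prod card_ord mulnn.
pose F a := enum_val (cast_ord (esym (card_free ot)) a).
pose dp b : 'I_m.+1 * 'I_m.+1 := enum_val (cast_ord cp b).
pose pd p : 'I_(m.+1 ^ 2) := cast_ord (esym cp) (enum_rank p).
have dpK : cancel pd dp by move=> p; rewrite /dp /pd cast_ordKV enum_rankK.
have pdK : cancel dp pd by move=> b; rewrite /dp /pd enum_valK cast_ordK.
have F_free a : is_free t o (F a).
  by have := enum_valP (cast_ord (esym (card_free ot)) a); rewrite inE.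
have F_inj : injective F by move=> a b /enum_val_inj /cast_ord_inj.
have F_onto s : is_free t o s -> exists a, F a = s.
  move=> fs; have fs' : s \in [pred s | is_free t o s] by rewrite inE.
  exists (cast_ord (card_free ot) (enum_rank_in fs' s)).
  by rewrite /F cast_ordK enum_rankK_in.
have [rJ tr] := choice (fun p : 'I_m.+1 * 'I_m.+1 => analytic_taylor (r_analytic p.1 p.2)).
have near_all (P : 'I_m.+1 -> 'rV[R]_m.+1 -> Prop) :
    (forall i, \forall x \near (0 : 'rV[R]_m.+1), P i x) ->
    \forall x \near (0 : 'rV[R]_m.+1), forall i, P i x.
  exact: (filter_forall (nbhs_filter (0 : 'rV[R]_m.+1))).
have t0 : taylor (@jet_cst R m.+1 0) (cst 0) by exact: taylor_cst.
have jet0 w : @jet_cst R m.+1 0 w = 0 by case: w.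
exists F, (fun b => slot t o (dp b)) => phi psi phi_an psi_an; split.
- have [phiJ tphi] := choice (fun a => analytic_taylor (phi_an a)).
  have [psiJ tpsi] := choice (fun b => analytic_taylor (psi_an b)).
  (* The jet 0 off the range of F is a placeholder: [assemble] reads f only at free symbols, and F
     enumerates those. *)
  pose f s : jet R m.+1 := if [pick a | F a == s] is Some a then phiJ a else @jet_cst R m.+1 0.
  have fF a : f (F a) = phiJ a.
    by rewrite /f; case: pickP => [b /eqP /F_inj ->|/(_ a)] //; rewrite eqxx.
  have f_sym s : symmetric_jet (f s).
    by rewrite /f; case: pickP => [a _|_]; [case: (tphi a)|case: t0].
  have f_bnd s : exp_bounded (f s).
    by rewrite /f; case: pickP => [a _|_]; [case: (tphi a)|case: t0].
  pose ps p := extend_jet (psiJ (pd p)).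
  have [M [mu [M0 mu1 br bf bp]]] := @cauchy_data_bounded R m.+1 (fun i j => rJ (i, j)) f ps
    (fun i j => let: And3 _ b _ := tr (i, j) in b) f_bnd
    (fun p => extend_exp_bounded (let: And3 _ b _ := tpsi (pd p) in b)).
  have [||G [sG bG Gf Gp [Gt Gr]]] := jets_exist ot _ f_sym _ M0 mu1 br bf bp.
  + by move=> i j; case: (tr (i, j)).
  + by move=> p; apply: extend_symmetric; case: (tpsi (pd p)).
  pose g s := ev (G s).
  have tG s : taylor (G s) (g s) by exact: ev_taylor.
  have g_an s : analytic (g s) by exact: taylor_analytic (tG s).
  have cE := christoffel_connection_of g.
  exists (connection_of g); split; first split.
  + exact: connection_ofP.
  + move=> Y aY.
    have tz : \forall x \near (0 : 'rV[R]_m.+1), forall j, tau_of (fun s => g s x) j = 0.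
      apply: (near_all) => j; apply: taylor_eq t0.
      have -> : @jet_cst R m.+1 0 = fun w => tau_of (fun s => G s w) j.
        by apply/funext => w; rewrite jet0 Gt.
      exact: taylor_tau_of.
    apply: filterS2 tz (tau_connection_of g aY) => x x0 ->.
    by rewrite big1 // => j _; rewrite x0 mulr0.
  + suff h : \forall x \near (0 : 'rV[R]_m.+1), forall i j, ricci (connection_of g) x i j = r x i j.
      by apply: filterS h => x hx; apply/matrixP => i j; exact: hx.
    apply: (near_all) => i; apply: (near_all) => j.
    apply: taylor_eq (tr (i, j)).
    have -> : rJ (i, j) = ricci_jet G i j by apply/funext => w; rewrite Gr.
    exact: taylor_ricci.
  + split=> [a|b].
      by apply: taylor_eq (tphi a); rewrite cE -!surjective_pairing -fF -Gf //.
    apply: taylor_eq (tpsi b); rewrite cE -!surjective_pairing.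
    have -> : psiJ b = restrict_jet (G (slot t o (dp b))).
      by apply/esym/restrict_eq => w wt; rewrite Gp // /ps pdK.
    exact: taylor_restrict.
- move=> nabla nabla' [lc tc rc] [pc qc] [lc' tc' rc'] [pc' qc'].
  (* A solution is replaced by the jets of its symbols; by [taylor_unique] equations between germs
     become equations at every word. *)
  have jets nab : linear_connection nab -> tau_zero nab ->
      {near (0 : 'rV[R]_m.+1), ricci nab =1 r} ->
      {G : _ & (forall s, taylor (G s) (christoffel nab s.1.1 s.1.2 s.2)) /\
        (forall j w, tau_of (fun s => G s w) j = 0) /\
        (forall i j w, ricci_jet G i j w = rJ (i, j) w)}.
    move=> l tz rz.
    have [G tG] := choice (fun s : 'I_m.+1 * 'I_m.+1 * 'I_m.+1 =>
      analytic_taylor (christoffel_analytic s.1.1 s.1.2 s.2 l)).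
    exists G; split=> //; split=> [j w|i j w].
      have tj : taylor (fun w => tau_of (fun s => G s w) j) (cst 0).
        apply: near_taylor (taylor_tau_of tG j) _.
        by apply: filterS (tz _ (analytic_coord_field R j)) => x; rewrite tau_coord_field.
      by rewrite -[RHS](jet0 w) -(taylor_unique tj t0).
    have tR := taylor_ricci (nabla := nab) tG i j (fun _ _ _ => erefl).
    have -> // : ricci_jet G i j = rJ (i, j).
    apply: taylor_unique (tr (i, j)); apply: near_taylor tR _.
    by apply: filterS rz => x ->.
  have [G [tG [Gt Gr]]] := jets _ lc tc rc.
  have [G' [tG' [Gt' Gr']]] := jets _ lc' tc' rc'.
  have GG : G = G'.
    apply: (jets_unique ot _ _ Gt Gt' Gr Gr').
    + by move=> s; case: (tG s).
    + by move=> s; case: (tG' s).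
    + move=> s /F_onto [a <-]; apply: (@taylor_unique _ _ _ _ (phi a)).
        exact: near_taylor (tG _) (pc a).
      exact: near_taylor (tG' _) (pc' a).
    + move=> p; apply: restrict_inj; apply: (@taylor_unique _ _ _ _ (psi (pd p))).
        by apply: near_taylor (taylor_restrict (tG _)) _; have := qc (pd p); rewrite dpK.
      by apply: near_taylor (taylor_restrict (tG' _)) _; have := qc' (pd p); rewrite dpK.
  apply: same_christoffel => // i j k.
  by have := tG' (i, j, k); rewrite -GG => /(taylor_eq (tG (i, j, k))).
Qed.
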